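(* Under the standing hypotheses (H1)–(H6) below, the adjoint of the linear relation $T_0$ in $L^2((a,b);\varrho)$ is $T_{\max}$, i.e. $T_0^\ast=T_{\max}$.
   Context: Let $-\infty\le a<b\le\infty$ and $\varrho,\varsigma,\chi$ locally finite Borel measures on $(a,b)$ with: (H1) $\varrho$ positive; (H2) $\chi$ real-valued; (H3) $\varsigma$ real-valued with $\operatorname{supp}\varsigma=(a,b)$; (H4) $\varsigma(\{x\})\chi(\{x\})=\varsigma(\{x\})\varrho(\{x\})=0$ for all $x$; (H5) for every gap $(\alpha,\beta)$ of $\operatorname{supp}\varrho$ (an open interval in the complement of $\operatorname{supp}\varrho$ with $\alpha,\beta\in\operatorname{supp}\varrho$) and every $f\in\mathfrak{D}_\tau$ with $f(\alpha-)=f(\beta+)=0$ one has $f=0$ on $(\alpha,\beta)$; (H6) $\operatorname{supp}\varrho$ has more than one point. Notation: $\int_c^x h\,d\mu=\int_{[c,x)}h\,d\mu$ for $x>c$, $0$ for $x=c$, $-\int_{[x,c)}h\,d\mu$ for $x<c$; $AC_{loc}((a,b);\mu)$ consists of the functions $f(x)=f(c)+\int_c^x h\,d\mu$ with $h\in L^1_{loc}((a,b);|\mu|)$, $h=\frac{df}{d\mu}$. $\mathfrak{D}_\tau$ is the set of $f\in AC_{loc}((a,b);\varsigma)$ for which there is $F\in AC_{loc}((a,b);\varrho)$ with $F=-\frac{df}{d\varsigma}+\int_c^{\cdot} f\,d\chi$ $|\varsigma|$-a.e.; $\tau f:=\frac{dF}{d\varrho}$. In the Hilbert space $L^2((a,b);\varrho)$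 with $\langle f,g\rangle=\int g^\ast f\,d\varrho$, let $T_{\max}=\{(f,\tau f): f\in\mathfrak{D}_\tau,\ f,\tau f\in L^2((a,b);\varrho)\}\subseteq L^2\times L^2$ (a linear relation, possibly multi-valued), and $T_0=\{(f,\tau f)\in T_{\max}: f \text{ has compact support in }(a,b)\}$. The adjoint of a linear relation $T\subseteq L^2\times L^2$ is $T^\ast=\{(f,g): \langle f,v\rangle=\langle g,u\rangle \text{ for all }(u,v)\in T\}$. *)

(* Defs.v *)
From HB Require Import structures.
From mathcomp Require Import all_boot all_order all_algebra.
From mathcomp Require Import all_classical all_reals all_analysis.
From mathcomp Require complex.
Import complex.ComplexField.
Import Order.TTheory GRing.Theory Num.Theory.
Import numFieldNormedType.Exports.

Set Implicit Arguments.
Unset Strict Implicit.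
Unset Printing Implicit Defensive.

Local Open Scope classical_set_scope.
Local Open Scope ring_scope.

Notation Cx R := (complex.complex R).

Section SLDefs.
Context {R : realType}.
Implicit Types (a b : \bar R) (mu rho mp mn : {measure set R -> \bar R}).

Definition oi a b : set R := [set x | (a < x%:E)%E /\ (x%:E < b)%E].

(* mu is a locally finite positive Borel measure on (a,b)
   (modelled as a Borel measure on R concentrated on (a,b)) *)
Definition locfin a b mu :=
  mu (~` oi a b) = 0%E /\
  forall c d : R, (a < c%:E)%E -> (d%:E < b)%E -> (mu [set` `[c, d]] < +oo)%E.

(* (mp, mn) is the Jordan decomposition of a real-valued locally finite
   Borel measure mp - mn on (a,b): both locally finite, mutually singular.
   Its variation is |mp - mn| = mp + mn. *)
Definition locfin_signed a b mp mn :=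
  locfin a b mp /\ locfin a b mn /\
  exists S : set R, measurable S /\ mp (~` S) = 0%E /\ mn S = 0%E.

Definition smass mp mn (x : R) : R := fine (mp [set x]) - fine (mn [set x]).

Definition cint mu (A : set R) (h : R -> Cx R) : Cx R :=
  complex.Complex (\int[mu]_(x in A) complex.Re (h x))
                  (\int[mu]_(x in A) complex.Im (h x)).

Definition sint mp mn (A : set R) (h : R -> Cx R) : Cx R :=
  cint mp A h - cint mn A h.

Definition cintegrable mu (A : set R) (h : R -> Cx R) :=
  mu.-integrable A (fun x => (complex.Re (h x))%:E) /\
  mu.-integrable A (fun x => (complex.Im (h x))%:E).

Definition L1loc a b mp mn (h : R -> Cx R) :=
  forall c d : R, (a < c%:E)%E -> (d%:E < b)%E ->
    cintegrable mp [set` `[c, d]] h /\ cintegrable mn [set` `[c, d]] h.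

(* the oriented integral \int_c^x h dmu with the convention of the paper:
   \int_{[c,x)} if x > c, 0 if x = c, - \int_{[x,c)} if x < c;
   I A h is the integral of h over A w.r.t. the measure at hand *)
Definition iint (I : set R -> (R -> Cx R) -> Cx R) (c x : R) (h : R -> Cx R)
  : Cx R :=
  if c < x then I [set` `[c, x[] h else if x < c then - I [set` `[x, c[] h else 0.

(* f in AC_loc((a,b); mp - mn) with h as (a version of) df/d(mp - mn) *)
Definition isderiv a b mp mn (f h : R -> Cx R) :=
  L1loc a b mp mn h /\
  exists c, oi a b c /\
    forall x, oi a b x -> f x = f c + iint (sint mp mn) c x h.

(* F in AC_loc((a,b); rho), rho positive, with k as (a version of) dF/drho *)
Definition L1locP a b rho (k : R -> Cx R) :=
  forall c d : R, (a < c%:E)%E -> (d%:E < b)%E ->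
    cintegrable rho [set` `[c, d]] k.

Definition isderivP a b rho (F k : R -> Cx R) :=
  L1locP a b rho k /\
  exists c, oi a b c /\
    forall x, oi a b x -> F x = F c + iint (cint rho) c x k.

(* f in D_tau and tf is (a version of) tau f, for the differential expression
   with coefficients rho (positive), sigma = sp - sn, chi = xp - xn *)
Definition Dtau a b rho sp sn xp xn (f tf : R -> Cx R) :=
  exists (h F : R -> Cx R) (c : R),
    isderiv a b sp sn f h /\
    isderivP a b rho F tf /\
    oi a b c /\
    {ae sp, forall x, oi a b x -> F x = - h x + iint (sint xp xn) c x f} /\
    {ae sn, forall x, oi a b x -> F x = - h x + iint (sint xp xn) c x f}.

Definition L2 a b rho (u : R -> Cx R) :=
  measurable_fun (oi a b) (fun x => complex.Re (u x)) /\
  measurable_fun (oi a b) (fun x => complex.Im (u x)) /\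
  (\int[rho]_(x in oi a b)
     ((complex.Re (u x)) ^+ 2 + (complex.Im (u x)) ^+ 2)%:E < +oo)%E.

Definition ip a b rho (f g : R -> Cx R) : Cx R :=
  cint rho (oi a b) (fun x => complex.conjc (g x) * f x).

(* T_max, as a relation on representatives of L^2 classes *)
Definition Tmax a b rho sp sn xp xn (u v : R -> Cx R) :=
  L2 a b rho u /\ L2 a b rho v /\
  exists f tf, Dtau a b rho sp sn xp xn f tf /\
    {ae rho, forall x, oi a b x -> u x = f x} /\
    {ae rho, forall x, oi a b x -> v x = tf x}.

Definition T0 a b rho sp sn xp xn (u v : R -> Cx R) :=
  L2 a b rho u /\ L2 a b rho v /\
  exists f tf, Dtau a b rho sp sn xp xn f tf /\
    (exists c d : R, (a < c%:E)%E /\ (d%:E < b)%E /\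
       forall x, oi a b x -> (x < c \/ d < x) -> f x = 0) /\
    {ae rho, forall x, oi a b x -> u x = f x} /\
    {ae rho, forall x, oi a b x -> v x = tf x}.

Definition adjoint a b rho (T : (R -> Cx R) -> (R -> Cx R) -> Prop)
  (f g : R -> Cx R) :=
  L2 a b rho f /\ L2 a b rho g /\
  forall u v, T u v -> ip a b rho f v = ip a b rho g u.

Definition supp a b (m : set R -> \bar R) (x : R) :=
  oi a b x /\ forall e : R, 0 < e -> (0%E < m [set y : R | (x - e < y < x + e)%R])%E.

Definition gap a b rho (al be : R) :=
  supp a b rho al /\ supp a b rho be /\ al < be /\
  forall x, al < x < be -> ~ supp a b rho x.

Definition left_lim0 (f : R -> Cx R) (al : R) :=
  (complex.Re (f x) @[x --> al^'-] --> (0 : R)) /\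
  (complex.Im (f x) @[x --> al^'-] --> (0 : R)).
Definition right_lim0 (f : R -> Cx R) (be : R) :=
  (complex.Re (f x) @[x --> be^'+] --> (0 : R)) /\
  (complex.Im (f x) @[x --> be^'+] --> (0 : R)).

End SLDefs.

(* Main.v *)
Require Import Defs.
From HB Require Import structures.
From mathcomp Require Import all_boot all_order all_algebra.
From mathcomp Require Import all_classical all_reals all_analysis.
From mathcomp Require complex.
From mathcomp Require Import measurable_realfun ring lra.
Import complex.ComplexField.
Import Order.TTheory GRing.Theory Num.Theory.
Import numFieldNormedType.Exports.
Local Open Scope classical_set_scope.
Local Open Scope ring_scope.

(* Let [mu = rho + |sigma| + |chi|] and let [s], [x], [r] be the densities of
   sigma, chi, rho with respect to [mu].  Real and imaginary parts decouple, and
   [tau f = g] becomes the linear system [df = q s dmu], [dq = (f x - g r) dmu] for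
   left-continuous [f] and [q]; (H4) says [s x = s r = 0] at the atoms of [mu].
   Fubini yields a product rule for such primitives.  It gives Lagrange's identity
   [d(f p - u q) = (u g - f w) r dmu] if [tau f = g] and [tau u = w], and, by
   iteration, the factorial bounds that make the Picard series of the initial
   value problem converge.

   If [u] vanishes outside a compact set, then so does its quasi-derivative, because
   [supp sigma = (a,b)]; Lagrange's identity then gives [T_max <= T_0^*].
   Conversely let [(f,g)] be in [T_0^*], let [tau f' = g], and let [u1], [u2] be a
   fundamental system of [tau u = 0].  A bounded compactly supported [w] orthogonal
   to [u1] and [u2] is [tau u] for some compactly supported [u], so that
   [<f,w> = <g,u> = <f',w>].  Hence [f - f'] is a combination of [u1] and [u2] as a
   functional of [w], and therefore rho-almost everywhere. *)

(** A common reference measure turns integration by parts between different measures into a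
    statement about two densities. The obstacle is the atoms. There the product of two
    left-continuous primitives jumps by an additional term, the product of both jumps; and to the
    left of a base point the integral over [[x, c)] involves the unknown values at [x] itself. In
    the system both effects carry a factor [s x] or [s r] at an atom, so (H4) removes them.

    The step from the adjoint of [T_0] to [T_max] is algebraic: a functional that vanishes on the
    common kernel of two others is a combination of them. Since the coefficients are real, testing
    with real [u] and [w] recovers the real and imaginary parts of [(f,g)] one at a time.

    Relations that hold only almost everywhere are replaced by functions defined everywhere: the
    quasi-derivative is [q = \int f dchi - F], a genuine primitive that agrees with [df/dsigma]
    almost everywhere for [|sigma|]. Only such a [q] has point values, which the boundary terms of
    Lagrange's identity require. *)

Local Notation intg mu A w := (mu.-integrable A (EFin \o w)).

(** * Real-valued integrable functions *)

Section IntegralTools.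
Context {d} {T : measurableType d} {R : realType}.
Variable mu : {measure set T -> \bar R}.
Implicit Types (A : set T) (w h : T -> R).

Lemma intg_meas A w : intg mu A w -> measurable_fun A w.
Proof. by move=> /measurable_int/measurable_EFinP. Qed.

Lemma intgD A w h : measurable A -> intg mu A w -> intg mu A h ->
  intg mu A (fun t => w t + h t).
Proof. by move=> mA iw ih; exact: (integrableD mA iw ih). Qed.

Lemma intgB A w h : measurable A -> intg mu A w -> intg mu A h ->
  intg mu A (fun t => w t - h t).
Proof. by move=> mA iw ih; exact: (integrableB mA iw ih). Qed.

Lemma intgN A w : measurable A -> intg mu A w -> intg mu A (fun t => - w t).
Proof. by move=> mA iw; exact: (integrableN iw). Qed.

Lemma intgZ A k w : measurable A -> intg mu A w -> intg mu A (fun t => k * w t).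
Proof. by move=> mA iw; exact: (integrableZl mA k iw). Qed.

Lemma intg0 A : measurable A -> intg mu A (fun=> 0).
Proof. by move=> mA; exact: (integrable0 mu A). Qed.

Lemma eq_intg A w h : measurable A -> (forall t, A t -> w t = h t) ->
  intg mu A w -> intg mu A h.
Proof.
by move=> mA e; apply: eq_integrable => // t /set_mem/e /= ->.
Qed.

Lemma le_intg A w h : measurable A -> measurable_fun A w ->
  (forall t, A t -> `|w t| <= `|h t|) -> intg mu A h -> intg mu A w.
Proof.
move=> mA mw le; apply: le_integrable => //; exact/measurable_EFinP.
Qed.

Lemma intgM A (C : R) h w : measurable A -> measurable_fun A h ->
  (forall t, A t -> `|h t| <= C) -> intg mu A w ->
  intg mu A (fun t => h t * w t).
Proof.
move=> mA mh hC iw; apply: (@le_intg _ _ (fun t => C * w t)) => //.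
- by apply: measurable_funM => //; exact: intg_meas.
- move=> t At; rewrite !normrM ler_wpM2r//.
  by rewrite (le_trans (hC _ At))// ler_norm.
- exact: intgZ.
Qed.

Lemma intgMr A (C : R) h w : measurable A -> measurable_fun A h ->
  (forall t, A t -> `|h t| <= C) -> intg mu A w ->
  intg mu A (fun t => w t * h t).
Proof.
move=> mA mh hC iw; apply: (eq_intg A (fun t => h t * w t)) => //.
  by move=> t _; rewrite mulrC.
exact: intgM hC _.
Qed.

Lemma intg_bounded A (C : R) h : measurable A -> (mu A < +oo)%E ->
  measurable_fun A h -> (forall t, A t -> `|h t| <= C) -> intg mu A h.
Proof.
move=> mA Afin mh hC; apply: measurable_bounded_integrable => //.
exists C; split; first exact: num_real.
by move=> M CM t At; apply: le_trans (hC _ At) (ltW CM).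
Qed.

Lemma eq_Rint A w h : (forall t, A t -> w t = h t) ->
  \int[mu]_(t in A) w t = \int[mu]_(t in A) h t.
Proof. by move=> e; apply: eq_Rintegral => t /set_mem/e. Qed.

Lemma Rint_subset A B w : measurable A -> measurable B -> A `<=` B ->
  intg mu B w -> \int[mu]_(t in A) `|w t| <= \int[mu]_(t in B) `|w t|.
Proof.
move=> mA mB AB iw; have iwB := integrable_norm iw.
have iA : intg mu A (fun t => `|w t|) by exact: (integrableS mB mA AB).
rewrite /Rintegral fine_le//; [exact: integrable_fin_num..|].
apply: ge0_subset_integral => //.
by apply/measurable_EFinP; exact: (intg_meas _ _ iwB).
Qed.

Lemma Rint_sub A B C w : measurable A -> measurable B -> A `&` B = set0 ->
  A `|` B = C -> intg mu C w ->
  \int[mu]_(t in C) w t = \int[mu]_(t in A) w t + \int[mu]_(t in B) w t.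
Proof.
move=> mA mB AB <- iw; rewrite Rintegral_setU//.
by apply/disj_set2P.
Qed.

End IntegralTools.

(** * Fubini over moving sets and the product rule *)

Section ProductRule.
Context {R : realType} (mu : {sigma_finite_measure set R -> \bar R}).
Implicit Types (p q : R -> R) (B : set (R * R)).

Definition atom (t : R) : R := fine (mu [set t]).

(** The indicator is at most 1, so Tonelli bounds the double integral by the product of the
    integrals of [|p|] and [|q|]. This is the integrability that Fubini asks for below. *)
Lemma intg_prod_indic B p q : measurable B -> intg mu setT p -> intg mu setT q ->
  intg (mu \x mu)%E setT (fun z : R * R => \1_B z * (p z.1 * q z.2)).
Proof.
move=> mB ip iq.
have mp := intg_meas _ _ _ ip; have mq := intg_meas _ _ _ iq.
have mf : measurable_fun setT (fun z : R * R => \1_B z * (p z.1 * q z.2)).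
  apply: measurable_funM; first exact: measurable_indic.
  apply: measurable_funM.
    exact: (measurableT_comp mp measurable_fst).
  exact: (measurableT_comp mq measurable_snd).
apply/integrable12ltyP; first exact/measurable_EFinP.
have Ip : (\int[mu]_x `|(p x)%:E| < +oo)%E by case/integrableP : ip.
have Iq : (\int[mu]_x `|(q x)%:E| < +oo)%E by case/integrableP : iq.
have mnp : measurable_fun setT (fun x => `|(p x)%:E|)%E.
  by apply: measurableT_comp => //; exact/measurable_EFinP.
have mnq : measurable_fun setT (fun x => `|(q x)%:E|)%E.
  by apply: measurableT_comp => //; exact/measurable_EFinP.
apply: (@le_lt_trans _ _
  (\int[mu]_x (`|(p x)%:E| * \int[mu]_y `|(q y)%:E|))%E); last first.
  rewrite ge0_integralZr//; last by apply: integral_ge0.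
  by apply: lte_mul_pinfty => //; [exact: integral_ge0|
    rewrite ge0_fin_numE//; exact: integral_ge0].
apply: ge0_le_integral => //.
- by move=> x _; exact: integral_ge0.
- apply: (@measurable_fun_fubini_tonelli_F _ _ _ _ _ mu (fun z =>
    `|(\1_B z * (p z.1 * q z.2))%:E|%E)) => //.
  by apply: measurableT_comp => //; exact/measurable_EFinP.
- exact: emeasurable_funM.
- move=> x _; rewrite -ge0_integralZl//.
  apply: ge0_le_integral => //.
  + apply: measurableT_comp => //; apply/measurable_EFinP.
    exact: (measurableT_comp mf (measurable_pair1 x)).
  + exact: emeasurable_funM.
  + move=> y _; rewrite /= lee_fin !normrM.
    rewrite indicE; case: (_ \in _) => /=; first by rewrite normr1 mul1r.
    by rewrite normr0 mul0r mulr_ge0.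
Qed.

Lemma Rint_indic_section (A : set R) B p q t :
  (forall s, B (t, s) <-> A s) -> measurable A -> intg mu setT q ->
  [/\ intg mu setT (fun s => \1_B (t, s) * (p t * q s)) &
  \int[mu]_s (\1_B (t, s) * (p t * q s)) = p t * \int[mu]_(s in A) q s].
Proof.
move=> BA mA iq.
have iqA : intg mu A q by exact: (integrableS measurableT mA).
have e s : \1_B (t, s) * (p t * q s) = p t * (q \_ A) s.
  rewrite patchE indicE.
  have -> : ((t, s) \in B) = (s \in A) by apply/idP/idP; rewrite !inE BA.
  by case: (s \in A); rewrite ?mul1r ?mul0r ?mulr0.
have iqA' : intg mu setT (q \_ A).
  rewrite (_ : _ \o _ = (EFin \o q) \_ A); last by rewrite restrict_EFin.
  by apply/(integrable_mkcond _ mA).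
split; first by apply: (eq_intg _ _ (fun s => p t * (q \_ A) s)) => //; exact: intgZ.
rewrite (eq_Rint _ _ _ _ (fun s _ => e s)) RintegralZl//.
by rewrite [in RHS]Rintegral_mkcond.
Qed.

Lemma intg_section (A : R -> set R) B p q : measurable B ->
  (forall t s, B (t, s) <-> A t s) -> (forall t, measurable (A t)) ->
  intg mu setT p -> intg mu setT q ->
  intg mu setT (fun t => p t * \int[mu]_(s in A t) q s).
Proof.
move=> mB BA mA ip iq.
have := integrable_fubini_F (intg_prod_indic B p q mB ip iq).
apply: eq_integrable => // t _; rewrite /fubini_F/=.
have [i <-] := Rint_indic_section (A t) B p q t (BA t) (mA t) iq.
by rewrite /Rintegral fineK//; exact: integrable_fin_num.
Qed.

(** Fubini for the kernel [\1_B], with [A] and [A'] the sections of [B] in the two directions. *)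
Lemma Rint_section_swap (A A' : R -> set R) B p q : measurable B ->
  (forall t s, B (t, s) <-> A t s) -> (forall t s, B (t, s) <-> A' s t) ->
  (forall t, measurable (A t)) -> (forall t, measurable (A' t)) ->
  intg mu setT p -> intg mu setT q ->
  \int[mu]_t (p t * \int[mu]_(s in A t) q s) =
  \int[mu]_s (q s * \int[mu]_(t in A' s) p t).
Proof.
move=> mB BA BA' mA mA' ip iq; rewrite {1 3}/Rintegral; congr fine.
transitivity (\int[mu]_t \int[mu]_s (\1_B (t, s) * (p t * q s))%:E)%E.
  apply: eq_integral => t _.
  have [i <-] := Rint_indic_section (A t) B p q t (BA t) (mA t) iq.
  by rewrite /Rintegral fineK//; exact: integrable_fin_num.
rewrite (Fubini (intg_prod_indic B p q mB ip iq)).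
apply: eq_integral => s _.
pose B' := [set z : R * R | B (z.2, z.1)].
have BB t : (t, s) \in B = ((s, t) \in B') by apply/idP/idP; rewrite !inE.
have [i <-] := Rint_indic_section (A' s) B' q p s (fun t => BA' t s) (mA' s) ip.
rewrite /Rintegral fineK//; last exact: integrable_fin_num.
by apply: eq_integral => t _; rewrite /= !indicE BB [q s * _]mulrC.
Qed.

Lemma Rint_set1 q t : (mu [set t] < +oo)%E ->
  \int[mu]_(s in [set t]) q s = q t * atom t.
Proof.
move=> fin; rewrite (eq_Rint _ _ _ (fun=> q t)) ?Rintegral_cst//.
by move=> s ->.
Qed.

(** The diagonal has the sections [{t}], so the atom term of the product rule is also an integral
    over sections. *)
Lemma measurable_diag : measurable [set z : R * R | z.1 = z.2].
Proof.
rewrite (_ : [set _ | _] = (fun z : R * R => z.1 - z.2) @^-1` [set 0]).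
  rewrite -[X in measurable X]setTI.
  have m : measurable_fun setT (fun z : R * R => z.1 - z.2).
    by apply: measurable_funB; [exact: measurable_fst|exact: measurable_snd].
  exact: (m measurableT [set 0] (measurable_set1 0)).
by apply/seteqP; split => z /= => [->|/eqP]; rewrite ?subrr// subr_eq0 => /eqP.
Qed.

Section Kernel.
Variable K : R -> set R.
Hypothesis mgraph : measurable [set z : R * R | K z.1 z.2].
Hypothesis Ktrans : forall x t s, K x t -> K t s -> K x s.
Hypothesis Kirr : forall x, ~ K x x.
Hypothesis Ktotal : forall x s t, K x s -> K x t -> [\/ K s t, K t s | s = t].

Lemma measurable_kernel x : measurable (K x).
Proof.
rewrite (_ : K x = xsection [set z : R * R | K z.1 z.2] x).
  exact: measurable_xsection.
by apply/seteqP; split => t; rewrite /xsection/= inE.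
Qed.
#[local] Hint Resolve measurable_kernel : core.

(** [K x] stands for the strict predecessors of [x]: [[c, x)] to the right of a base point, [(x, c)]
    to its left. The square of [K X] splits into two triangles and the diagonal. One triangle is the
    first summand, Fubini turns the other into the second, and the diagonal contributes the
    atoms. *)
Lemma kernel_product_rule X p q : (mu (K X) < +oo)%E ->
  intg mu (K X) p -> intg mu (K X) q ->
  [/\ intg mu (K X) (fun t => p t * \int[mu]_(s in K t) q s),
      intg mu (K X) (fun t => q t * \int[mu]_(s in K t) p s),
      intg mu (K X) (fun t => p t * q t * atom t) &
      (\int[mu]_(t in K X) p t) * (\int[mu]_(t in K X) q t) =
      \int[mu]_(t in K X) (p t * (\int[mu]_(s in K t) q s) +
        q t * (\int[mu]_(s in K t) p s) + p t * q t * atom t)].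
Proof.
move=> Xfin ip iq; set S := K X; have mS : measurable S by exact: measurable_kernel.
(* Fubini is available on the whole line, so [p] and [q] are extended by zero off [S]. *)
have tot f : intg mu S f -> intg mu setT (f \_ S).
  move=> i; rewrite (_ : _ \o _ = (EFin \o f) \_ S); last by rewrite restrict_EFin.
  by apply/(integrable_mkcond _ mS).
have sub t : S t -> K t `<=` S by move=> St s; exact: Ktrans.
have restr f A : A `<=` S -> \int[mu]_(s in A) (f \_ S) s = \int[mu]_(s in A) f s.
  by move=> AS; apply: eq_Rint => s /AS Ss; rewrite patchE mem_set.
have back f : intg mu setT f -> intg mu S f by apply: integrableS.
have fin1 t : S t -> (mu [set t] < +oo)%E.
  by move=> St; apply: le_lt_trans Xfin; apply: le_measure; rewrite ?inE// => s ->.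
have ipT := tot _ ip; have iqT := tot _ iq.
have piece f g : intg mu S f -> intg mu S g ->
    intg mu S (fun t => f t * \int[mu]_(s in K t) g s).
  move=> i_f ig.
  apply: (eq_intg _ _ (fun t => (f \_ S) t * \int[mu]_(s in K t) (g \_ S) s)) => //.
    by move=> t St; rewrite patchE mem_set// restr//; exact: sub.
  apply: back; apply: (intg_section K _ _ _ mgraph) => //; exact: tot.
have i1 := piece _ _ ip iq; have i2 := piece _ _ iq ip.
have i3 : intg mu S (fun t => p t * q t * atom t).
  apply: (eq_intg _ _ (fun t => (p \_ S) t * \int[mu]_(s in [set t]) (q \_ S) s)) => //.
    by move=> t St; rewrite Rint_set1 ?fin1// !patchE mem_set// mulrA.
  apply: back; apply: (intg_section (fun t => [set t]) _ _ _ measurable_diag) => //.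
split => //.
(* The successors of [t] within [S]: what remains of [S] besides [K t] and [t]. *)
pose C t := [set s | S s /\ S t /\ K s t].
have mC : measurable [set z : R * R | C z.1 z.2].
  rewrite (_ : [set _ | _] = (setT `*` S) `&` (S `*` setT) `&`
      (fun z : R * R => (z.2, z.1)) @^-1` [set z | K z.1 z.2]).
    apply: measurableI; first by apply: measurableI; exact: measurableX.
    rewrite -[X in measurable X]setTI; exact: (measurable_swap measurableT).
  by apply/seteqP; split => -[t s] /=; rewrite /C/=; tauto.
have mCt t : measurable (C t).
  rewrite (_ : C t = xsection [set z : R * R | C z.1 z.2] t).
    exact: measurable_xsection.
  by apply/seteqP; split => s; rewrite /xsection/= inE.
have split3 t : S t -> \int[mu]_(s in S) q s =
    \int[mu]_(s in K t) q s + q t * atom t + \int[mu]_(s in C t) q s.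
  move=> St.
  rewrite (Rint_sub mu (K t `|` [set t]) (C t) S)//; first last.
  - apply/seteqP; split => s; first by move=> [[/(sub _ St)//|->//]|[]].
    by move=> Ss; have [] := Ktotal _ _ _ Ss St; rewrite /C/=; tauto.
  - apply/seteqP; split => s //= -[[Kts|->] [_ [_ Kst]]]; last exact: (Kirr _ Kst).
    exact: (Kirr _ (Ktrans _ _ _ Kts Kst)).
  - exact: measurableU.
  rewrite (Rint_sub mu (K t) [set t] (K t `|` [set t]))//; first last.
  - apply: integrableS iq => //; first exact: measurableU.
    by move=> s [/(sub _ St)//|->].
  - by apply/seteqP; split => s //= [Kts ts]; rewrite ts in Kts; exact: (Kirr _ Kts).
  by rewrite Rint_set1 ?fin1.
have i4 : intg mu S (fun t => p t * \int[mu]_(s in C t) q s).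
  apply: (eq_intg _ _ (fun t => (p \_ S) t * \int[mu]_(s in C t) (q \_ S) s)) => //.
    by move=> t St; rewrite patchE mem_set// restr// => s [].
  by apply: back; apply: (intg_section C _ _ _ mC).
(* Fubini reverses this triangle: the points that have [t] among their successors form exactly
   [K t]. *)
have e4 : \int[mu]_(t in S) (p t * \int[mu]_(s in C t) q s) =
    \int[mu]_(t in S) (q t * \int[mu]_(s in K t) p s).
  transitivity (\int[mu]_t ((p \_ S) t * \int[mu]_(s in C t) (q \_ S) s)).
    rewrite [in LHS]Rintegral_mkcond; apply: eq_Rint => t _; rewrite !patchE.
    case: ifPn => [_|_]; last by rewrite mul0r.
    by rewrite restr// => s [].
  pose C' s := [set t | C t s].
  rewrite (Rint_section_swap C C' _ _ _ mC)//.
    rewrite [in RHS]Rintegral_mkcond; apply: eq_Rint => t _; rewrite !patchE.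
    case: ifPn => [/set_mem St|_]; last by rewrite mul0r.
    have -> : C' t = K t.
      apply/seteqP; split => s; rewrite /C' /C/=; first tauto.
      by move=> Kts; split => //; split => //; exact: (Ktrans _ _ _ St Kts).
    by rewrite restr//; exact: sub.
  move=> s; rewrite (_ : C' s = ysection [set z : R * R | C z.1 z.2] s).
    exact: measurable_ysection.
  by apply/seteqP; split => t; rewrite /ysection/= inE.
rewrite -RintegralZr//.
rewrite (eq_Rint _ _ _ (fun t => (p t * \int[mu]_(s in K t) q s + p t * q t * atom t)
   + p t * \int[mu]_(s in C t) q s)); last first.
  by move=> t St; rewrite (split3 t St) !mulrDr mulrA.
rewrite RintegralD//; last exact: intgD.
rewrite e4 -RintegralD//; last exact: intgD.
by apply: eq_Rint => t _; rewrite addrAC.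
Qed.

End Kernel.
End ProductRule.

(** * Radon-Nikodym densities of sigma-finite measures *)

Section Density.
Context {d} {T : measurableType d} {R : realType}.

(** The space is cut into disjoint pieces of finite [nu]-measure, and the Radon-Nikodym derivatives
    of the restrictions are glued. Their values are finite, so the density can be real-valued
    everywhere. *)
Lemma density_exists (mu nu : {sigma_finite_measure set T -> \bar R}) :
  nu `<< mu ->
  exists s : T -> R, [/\ measurable_fun setT s, (forall x, 0 <= s x) &
    forall (A : set T) (f : T -> \bar R), measurable A -> measurable_fun A f ->
      (forall x, 0 <= f x)%E ->
      (\int[nu]_(x in A) f x = \int[mu]_(x in A) (f x * (s x)%:E))%E].
Proof.
move=> numu; have [F FT Fin] := sigma_finiteT nu.
pose E := seqDU F.
have mE n : measurable (E n).
  apply: measurableD; first exact: (Fin n).1.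
  by apply: bigsetU_measurable => i _; exact: (Fin i).1.
have ET : \bigcup_n E n = setT by rewrite FT -seqDU_bigcup_eq.
have tE : trivIset setT E by exact: trivIset_seqDU.
have finE n : (nu (E n) < +oo)%E.
  apply: le_lt_trans (Fin n).2; apply: le_measure; rewrite ?inE//.
  - exact: (Fin n).1.
  - by apply: subDsetl.
pose nuE n : {finite_measure set T -> \bar R} := mfrestr (mE n) (finE n).
have nuEmu n : nuE n `<< mu.
  move=> A muA B mB BA; rewrite /nuE/= /mfrestr/mrestr/=.
  apply: (numu _ muA) => //; first exact: measurableI.
  by move=> x [/BA].
pose D n := Radon_Nikodym_SigmaFinite.f (nuE n) mu.
have Dge0 n x : (0 <= D n x)%E by exact: Radon_Nikodym_SigmaFinite.f_ge0.
have Dfin n x : D n x \is a fin_num by exact: Radon_Nikodym_SigmaFinite.f_fin_num.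
have kex x : exists n, E n x by have : setT x by []; rewrite -ET => -[n _ ?]; exists n.
(* The index of the piece containing [x], unique because the pieces are disjoint. *)
pose k x := sval (cid (kex x)).
have kE n x : E n x -> k x = n.
  move=> Enx; rewrite /k; case: cid => m /= Emx.
  by apply: tE => //; exists x.
pose s x := fine (D (k x) x).
have ms : measurable_fun setT s.
  rewrite -ET; apply/measurable_fun_bigcup => // n.
  apply: (eq_measurable_fun (fun x => fine (D n x))).
    by move=> x /set_mem/kE; rewrite /s => ->.
  apply: measurableT_comp => //; apply: measurable_funTS.
  by apply: (measurable_int mu); exact: Radon_Nikodym_SigmaFinite.f_integrable.
exists s; split => //; first by move=> x; rewrite /s fine_ge0.
move=> A f mA mf f0.
have AE : A = \bigcup_n (A `&` E n) by rewrite -setI_bigcupr ET setIT.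
have mAE n : measurable (A `&` E n) by exact: measurableI.
have tAE : trivIset setT (fun n => A `&` E n) by exact: trivIset_setIl.
rewrite AE !ge0_integral_bigcup//; first last.
- by rewrite -AE.
- by move=> x _; rewrite mule_ge0// lee_fin /s fine_ge0.
- rewrite -AE; apply: emeasurable_funM => //.
  by apply/measurable_EFinP; exact: measurable_funTS.
apply: eq_eseriesr => n _.
transitivity (\int[nuE n]_(x in A `&` E n) f x)%E.
  apply: eq_measure_integral => B mB BA; rewrite /nuE/= /mfrestr/mrestr/=.
  by congr (nu _); apply/seteqP; split => [x Bx|x []//]; split => //; have [] := BA _ Bx.
rewrite -(Radon_Nikodym_SigmaFinite.change_of_variables (nuEmu n))//; last first.
  by apply: measurable_funS mf => // x [].
by apply: eq_integral => x /set_mem[_ /kE kx]; rewrite /s kx fineK.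
Qed.

End Density.

(** * Linear Volterra equations *)

Section Volterra.
Context {R : realType} (mu : {sigma_finite_measure set R -> \bar R}).
Variable K : R -> set R.
Hypothesis mgraph : measurable [set z : R * R | K z.1 z.2].
Hypothesis Ktrans : forall x t s, K x t -> K t s -> K x s.
Hypothesis Kirr : forall x, ~ K x x.
Hypothesis Ktotal : forall x s t, K x s -> K x t -> [\/ K s t, K t s | s = t].
Variable D : R -> Prop.
Hypothesis DK : forall x t, D x -> K x t -> D t.
Hypothesis Dfin : forall x, D x -> (mu (K x) < +oo)%E.

Let mK x : measurable (K x). Proof. exact: measurable_kernel. Qed.
#[local] Hint Resolve mK : core.

(** The product rule with [p = 1] makes the running integral integrable over [K X], in particular
    measurable. The constant is integrable there because [K X] has finite measure. *)
Lemma measurable_kernel_integral X w : D X -> intg mu (K X) w ->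
  measurable_fun (K X) (fun t => \int[mu]_(s in K t) w s).
Proof.
move=> DX iw; have fin := Dfin _ DX.
have i1 : intg mu (K X) (fun=> 1) by apply: (intg_bounded _ _ 1) => // t _; rewrite normr1.
have [i _ _ _] := kernel_product_rule mu K mgraph Ktrans Kirr Ktotal X _ _ fin i1 iw.
by apply: eq_measurable_fun (intg_meas _ _ _ i) => t _; rewrite mul1r.
Qed.

Variable A : R -> R.
Hypothesis A0 : forall t, 0 <= A t.
Hypothesis iA : forall X, D X -> intg mu (K X) A.

Let m x := \int[mu]_(t in K x) A t.

Let m0 x : 0 <= m x. Proof. by apply: Rintegral_ge0 => t _. Qed.

Let m_le X t : D X -> K X t -> m t <= m X.
Proof.
move=> DX Kt; have := @Rint_subset _ _ _ mu (K t) (K X) A (mK t) (mK X).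
have nA (S : set R) : \int[mu]_(x in S) `|A x| = \int[mu]_(x in S) A x.
  by apply: eq_Rint => x _; rewrite ger0_norm.
by rewrite !nA; apply; [move=> s; exact: Ktrans Kt|exact: iA].
Qed.

Let mm X : D X -> measurable_fun (K X) m.
Proof. by move=> DX; apply: measurable_kernel_integral => //; exact: iA. Qed.

Let atom0 t : 0 <= atom mu t. Proof. by rewrite /atom fine_ge0. Qed.

(* A density of [m ^+ n.+1] with respect to [mu], from iterating the product rule. *)
Fixpoint power_density n t : R := if n is k.+1 then
    A t * m t ^+ k.+1 + power_density k t * m t + A t * power_density k t * atom mu t
  else A t.

(** Atoms only help: the [atom] terms are nonnegative, and the others give
    [d(m ^+ n.+1) >= n.+1 * m ^+ n dm] by induction. *)
Let power_density_ge n t : n.+1%:R * (A t * m t ^+ n) <= power_density n t.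
Proof.
elim: n => [|n IH]; first by rewrite expr0 mulr1 mul1r.
have pd0 : 0 <= power_density n t.
  by apply: le_trans IH; rewrite !mulr_ge0// exprn_ge0.
rewrite /= -[leLHS]addr0 lerD//; last by rewrite !mulr_ge0.
rewrite -addn1 natrD mulrDl mul1r addrC lerD2l.
by rewrite exprSr !mulrA ler_wpM2r// -mulrA.
Qed.

Let power_densityP n : forall X, D X -> intg mu (K X) (power_density n) /\
  m X ^+ n.+1 = \int[mu]_(t in K X) power_density n t.
Proof.
elim: n => [|n IH] X DX; first by split; [exact: iA|rewrite expr1].
have [i1 i2 i3 e] := kernel_product_rule mu K mgraph Ktrans Kirr Ktotal X _ _
  (Dfin _ DX) (iA _ DX) (IH _ DX).1.
have eq t : K X t -> A t * \int[mu]_(s in K t) power_density n s +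
     power_density n t * \int[mu]_(s in K t) A s + A t * power_density n t * atom mu t
   = power_density n.+1 t.
  by move=> Kt; rewrite /= -(IH _ (DK _ _ DX Kt)).2.
split.
  apply: eq_intg eq _ => //.
  by apply: intgD => //; apply: intgD.
by rewrite -(eq_Rint _ _ _ _ eq) -e exprS -(IH _ DX).2.
Qed.

(** The source of the factorials: each integration against [A] gains a factor [1 / n.+1], as for
    powers of a continuous [m]. *)
Let int_power n X : D X -> intg mu (K X) (fun t => A t * m t ^+ n) /\
  \int[mu]_(t in K X) (A t * m t ^+ n) <= m X ^+ n.+1 / n.+1%:R.
Proof.
move=> DX; have i : intg mu (K X) (fun t => A t * m t ^+ n).
  apply: (intgMr _ _ (m X ^+ n)) => //; last exact: iA.
    by apply: measurable_funX; exact: mm.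
  move=> t Kt; rewrite ger0_norm ?exprn_ge0//.
  by rewrite lerXn2r ?nnegrE//; exact: m_le.
split => //; rewrite ler_pdivlMr ?ltr0n// mulrC -RintegralZl//.
have [ip ->] := power_densityP n X DX.
by apply: le_Rintegral => //; exact: intgZ.
Qed.

Variables (b a : bool -> R -> R).
Hypothesis aA : forall e t, `|a e t| <= A t.
Hypothesis ma : forall e X, D X -> measurable_fun (K X) (a e).
Hypothesis mb : forall e X, D X -> measurable_fun (K X) (b e).
Hypothesis bb : forall X, D X -> exists C : R, forall e t, t = X \/ K X t -> `|b e t| <= C.

(** The [n]-th term of the Picard series. The Boolean names one of two unknowns, and [~~ e] reflects
    that each equation is driven by the other unknown. *)
Fixpoint volterra_iter n e X : R := if n is k.+1 then
  \int[mu]_(t in K X) (a e t * volterra_iter k (~~ e) t) else b e X.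
Local Notation v := volterra_iter.

Let iaw e X (C : R) (w : R -> R) : D X -> measurable_fun (K X) w ->
  (forall t, K X t -> `|w t| <= C) -> intg mu (K X) (fun t => a e t * w t).
Proof.
move=> DX mw wC; apply: (intgMr _ _ C) => //.
apply: (le_intg _ _ _ A) => //; first exact: ma.
  by move=> t _; rewrite (ger0_norm (A0 t)).
exact: iA.
Qed.

(** Measurability and the bound go through one induction, since together they make the integrand of
    the next iterate integrable. The constant [C] belongs to [X] and passes to every [t] in [K X] by
    transitivity. *)
Let vP n : (forall e X, D X -> measurable_fun (K X) (v n e)) /\
  (forall e X (C : R), D X -> (forall e t, t = X \/ K X t -> `|b e t| <= C) ->
    `|v n e X| <= C * (m X ^+ n / n`!%:R)).
Proof.
elim: n => [|n [IHm IHb]].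
  split; first exact: mb.
  by move=> e X C DX hC; rewrite expr0 fact0 invr1 !mulr1; apply: hC; left.
have bnd (C : R) X e t : D X -> (forall e t, t = X \/ K X t -> `|b e t| <= C) ->
    K X t -> `|v n e t| <= C * (m t ^+ n / n`!%:R).
  move=> DX hC Kt; apply: IHb; first exact: DK Kt.
  move=> e' t' [->|Ktt]; apply: hC; right => //; exact: Ktrans Ktt.
have C0 (C : R) X : (forall e t, t = X \/ K X t -> `|b e t| <= C) -> 0 <= C.
  by move=> hC; apply: le_trans (hC true X (or_introl erefl)).
have iav e X : D X -> intg mu (K X) (fun t => a e t * v n (~~ e) t).
  move=> DX; have [C hC] := bb _ DX.
  apply: (iaw e X (C * (m X ^+ n / n`!%:R))) => //; first exact: IHm.
  move=> t Kt; apply: le_trans (bnd C X _ t DX hC Kt) _.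
  rewrite ler_wpM2l ?(C0 _ _ hC)// ler_wpM2r ?invr_ge0//.
  by rewrite lerXn2r ?nnegrE//; exact: m_le.
split; first by move=> e X DX; exact: (measurable_kernel_integral X _ DX (iav e X DX)).
move=> e X C DX hC /=.
apply: (le_trans (le_normr_Rintegral (mK X) (iav e X DX))).
have [iAm leAm] := int_power n X DX.
apply: (@le_trans _ _ (\int[mu]_(t in K X) (C / n`!%:R * (A t * m t ^+ n)))).
  apply: le_Rintegral => //.
  - exact: (integrable_norm (iav e X DX)).
  - exact: intgZ.
  - move=> t Kt; rewrite normrM.
    rewrite (_ : _ / _ * _ = A t * (C * (m t ^+ n / n`!%:R))); last by ring.
    by apply: ler_pM => //; exact: bnd Kt.
rewrite RintegralZl//.
apply: le_trans (ler_wpM2l _ leAm) _; first by rewrite mulr_ge0 ?invr_ge0// (C0 _ _ hC).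
rewrite factS natrM invfM le_eqVlt; apply/orP; left; apply/eqP; ring.
Qed.

Let z e X := limn (series (fun n => v n e X)).

(** The exponential series of [m t] dominates, so [C * expR (m X)] bounds all partial sums on [K X]
    at once. This uniform bound, times [A], is the majorant for passing to the limit under the
    integral. *)
Let zP X : D X -> exists C : R, forall e t, t = X \/ K X t ->
  (series (fun n => v n e t) @ \oo --> z e t) /\
  (forall N, `|series (fun n => v n e t) N| <= C).
Proof.
move=> DX; have [C hC] := bb _ DX.
have C0 : 0 <= C by apply: le_trans (hC true X (or_introl erefl)).
exists (C * expR (m X)) => e t Kt.
have Dt : D t by case: Kt => [->//|]; exact: DK.
have mt : m t <= m X by case: Kt => [->//|]; exact: m_le.
have hCt e' t' : t' = t \/ K t t' -> `|b e' t'| <= C.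
  move=> h; apply: hC; case: Kt => [<-//|Kt]; right.
  by case: h => [->//|]; exact: Ktrans.
have bnd n : `|v n e t| <= C * exp_coeff (m t) n by apply: (vP n).2.
have ec0 n : 0 <= exp_coeff (m t) n by rewrite /exp_coeff/= divr_ge0// exprn_ge0.
split.
  apply: normed_cvg; apply: (@series_le_cvg _ _ (fun n => C * exp_coeff (m t) n)) => //.
  - by move=> n /=.
  - by move=> n; rewrite mulr_ge0.
  - exact: (@is_cvg_seriesZ _ _ C (is_cvg_series_exp_coeff (m t))).
move=> N; rewrite /series/=; apply: (le_trans (ler_norm_sum _ _ _)).
apply: (@le_trans _ _ (\sum_(0 <= k < N) C * exp_coeff (m t) k)); first exact: ler_sum.
rewrite -mulr_sumr ler_wpM2l//.
apply: (@le_trans _ _ (expR (m t))); last by rewrite ler_expR.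
apply: (nondecreasing_cvgn_le _ (is_cvg_series_exp_coeff (m t)) N).
exact: nondecreasing_series.
Qed.

Lemma volterra : exists z : bool -> R -> R, forall e X, D X ->
  [/\ measurable_fun (K X) (z e),
      (exists C : R, forall t, t = X \/ K X t -> `|z e t| <= C) &
      z e X = b e X + \int[mu]_(t in K X) (a e t * z (~~ e) t)].
Proof.
exists z => e X DX; have [C hC] := zP _ DX.
have mS e' N : measurable_fun (K X) (fun t => series (fun n => v n e' t) N).
  by apply: measurable_sum => i; exact: (vP i).1.
have mz e' : measurable_fun (K X) (z e').
  apply: (measurable_fun_cvg (mS e')) => t Kt.
  by have [] := hC e' t (or_intror Kt).
have zC e' t : t = X \/ K X t -> `|z e' t| <= C.
  move=> Kt; have [cv le] := hC e' t Kt.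
  have cvz : cvgn (series (fun n => v n e' t)) by exact: cvgP cv.
  rewrite ler_norml; apply/andP; split; [apply: limr_ge => //|apply: limr_le => //];
    by apply: nearW => N; move: (le N); rewrite ler_norml => /andP[].
split => //; first by exists C; exact: zC.
have iaS N : intg mu (K X) (fun t => a e t * series (fun n => v n (~~ e) t) N).
  apply: (iaw _ _ C) => // t Kt.
  by have [_] := hC (~~ e) t (or_intror Kt); apply.
have iaz : intg mu (K X) (fun t => a e t * z (~~ e) t).
  by apply: (iaw _ _ C) => // t Kt; apply: zC; right.
have iav n : intg mu (K X) (fun t => a e t * v n (~~ e) t).
  apply: (eq_intg _ _ (fun t => a e t * series (fun n => v n (~~ e) t) n.+1 -
     a e t * series (fun n => v n (~~ e) t) n)) => //; last exact: intgB.
  by move=> t _; rewrite -mulrBr seriesSB.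
(* Integrating the [N]-th partial sum gives the next partial sum without its first term [b e X]; the
   limit of both sides is the equation. *)
have partial N : \int[mu]_(t in K X) (a e t * series (fun n => v n (~~ e) t) N) =
    series (fun n => v n e X) N.+1 - b e X.
  elim: N => [|N IH].
    rewrite (eq_Rint _ _ _ (fun=> 0)); last by move=> t _; rewrite /series/= big_geq ?mulr0.
    by rewrite Rintegral_cst// mul0r /series/= big_nat1 subrr.
  rewrite (eq_Rint _ _ _ (fun t => a e t * series (fun n => v n (~~ e) t) N +
     a e t * v N (~~ e) t)); last first.
    by move=> t _; rewrite seriesSr mulrDr.
  by rewrite RintegralD// IH [in RHS]seriesSr addrAC.
have cv1 : (\int[mu]_(t in K X) (a e t * series (fun n => v n (~~ e) t) N)%:E)%E
    @[N --> \oo] --> (\int[mu]_(t in K X) (a e t * z (~~ e) t)%:E)%E.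
  apply: (@dominated_cvg _ _ _ mu (K X) (mK X)
     (fun N t => (a e t * series (fun n => v n (~~ e) t) N)%:E) _
     (fun t => (A t * C)%:E)) => //.
  - by move=> n; apply/measurable_EFinP; exact: (intg_meas _ _ _ (iaS n)).
  - move=> t Kt; apply: cvg_EFin; first exact: nearW.
    by apply: cvgMr; have [] := hC (~~ e) t (or_intror Kt).
  - by apply: (eq_intg _ _ (fun t => C * A t)) => //;
      [move=> t _; rewrite mulrC|apply: intgZ => //; exact: iA].
  - move=> n t Kt; rewrite lee_fin normrM; apply: ler_pM => //.
    by have [_] := hC (~~ e) t (or_intror Kt); apply.
have cv2 : \int[mu]_(t in K X) (a e t * series (fun n => v n (~~ e) t) N)
    @[N --> \oo] --> \int[mu]_(t in K X) (a e t * z (~~ e) t).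
  apply: fine_cvg; rewrite /Rintegral fineK//; exact: integrable_fin_num.
have cv3 : series (fun n => v n e X) N.+1 - b e X @[N --> \oo] --> z e X - b e X.
  apply: cvgB; last exact: cvg_cst.
  by rewrite (cvg_shiftS (series (fun n => v n e X))); have [] := hC e X (or_introl erefl).
have cv2' : series (fun n => v n e X) N.+1 - b e X @[N --> \oo] -->
    \int[mu]_(t in K X) (a e t * z (~~ e) t).
  by under eq_fun do rewrite -partial.
by rewrite (cvg_unique (@Rhausdorff R) cv2' cv3)// addrC subrK.
Qed.

End Volterra.

Section VolterraSystem.
Context {R : realType} (mu : {sigma_finite_measure set R -> \bar R}).
Variable K : R -> set R.
Hypothesis mgraph : measurable [set z : R * R | K z.1 z.2].
Hypothesis Ktrans : forall x t s, K x t -> K t s -> K x s.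
Hypothesis Kirr : forall x, ~ K x x.
Hypothesis Ktotal : forall x s t, K x s -> K x t -> [\/ K s t, K t s | s = t].
Variable D : R -> Prop.
Hypothesis DK : forall x t, D x -> K x t -> D t.
Hypothesis Dfin : forall x, D x -> (mu (K x) < +oo)%E.

(** [true] stands for [z1], driven through [s], and [false] for [z2], driven through [x]; the source
    [k] is integrated into the free term. *)
Lemma volterra_system (s x k : R -> R) (y1 y2 : R) :
  (forall X, D X -> intg mu (K X) s) -> (forall X, D X -> intg mu (K X) x) ->
  (forall X, D X -> intg mu (K X) k) ->
  exists z1 z2 : R -> R, forall X, D X ->
    [/\ intg mu (K X) (fun t => z1 t * x t), intg mu (K X) (fun t => z2 t * s t),
        z1 X = y1 + \int[mu]_(t in K X) (z2 t * s t) &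
        z2 X = y2 + \int[mu]_(t in K X) (z1 t * x t - k t)].
Proof.
move=> is_ ix ik; have mK X : measurable (K X) by exact: measurable_kernel.
pose A t := `|s t| + `|x t|.
pose aa (e : bool) := if e then s else x.
pose bb (e : bool) X := if e then y1 else y2 - \int[mu]_(t in K X) k t.
have A0 t : 0 <= A t by rewrite addr_ge0.
have iA X : D X -> intg mu (K X) A.
  by move=> DX; apply: intgD => //; apply: integrable_norm; [exact: is_|exact: ix].
have aA e t : `|aa e t| <= A t by case: e; rewrite /aa /A ?lerDl ?lerDr.
have ma e X : D X -> measurable_fun (K X) (aa e).
  by move=> DX; case: e; apply: (intg_meas mu); [exact: is_|exact: ix].
have mb e X : D X -> measurable_fun (K X) (bb e).
  move=> DX; rewrite /bb; case: e => //; apply: measurable_funB => //.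
  exact: (measurable_kernel_integral mu K mgraph Ktrans Kirr Ktotal D Dfin X k DX (ik _ DX)).
have bbd X : D X -> exists C : R, forall e t, t = X \/ K X t -> `|bb e t| <= C.
  move=> DX; exists (`|y1| + (`|y2| + \int[mu]_(t in K X) `|k t|)) => e t Kt.
  have Kt_sub : K t `<=` K X by case: Kt => [->//|Kt] u; exact: Ktrans Kt.
  have I0 : 0 <= \int[mu]_(t in K X) `|k t| by apply: Rintegral_ge0.
  case: e => /=; first by rewrite lerDl addr_ge0.
  apply: (@le_trans _ _ (`|y2| + \int[mu]_(t in K X) `|k t|)); last by rewrite lerDr.
  apply: le_trans (ler_normB _ _) _; rewrite lerD2l.
  apply: le_trans (le_normr_Rintegral _ _) _ => //.
    exact: integrableS Kt_sub (ik _ DX).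
  by apply: Rint_subset => //; exact: ik.
have [z zP] := volterra mu K mgraph Ktrans Kirr Ktotal D DK Dfin A A0 iA bb aa aA ma mb bbd.
exists (z true), (z false) => X DX.
have [m1 [C1 h1] e1] := zP true X DX; have [m2 [C2 h2] e2] := zP false X DX.
have i1 : intg mu (K X) (fun t => z true t * x t).
  by apply: (intgM _ _ C1) => //; [move=> t Kt; apply: h1; right|exact: ix].
have i2 : intg mu (K X) (fun t => z false t * s t).
  by apply: (intgM _ _ C2) => //; [move=> t Kt; apply: h2; right|exact: is_].
split => //.
  by rewrite e1; congr (_ + _); apply: eq_Rint => t _; rewrite mulrC.
rewrite RintegralB//; last exact: ik.
rewrite e2 /bb -addrA; congr (_ + _); rewrite addrC; congr (_ - _).
by apply: eq_Rint => t _; rewrite mulrC.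
Qed.

End VolterraSystem.

(** * Primitives on an open interval *)

Section IntegrableUnion.
Context {d} {T : measurableType d} {R : realType}.

Lemma intg_setU (mu : {measure set T -> \bar R}) (A B : set T) (w : T -> R) :
  measurable A -> measurable B -> intg mu A w -> intg mu B w ->
  intg mu (A `|` B) w.
Proof.
move=> mA mB /integrableP[mwA wA] /integrableP[mwB wB].
have mw : measurable_fun (A `|` B) (EFin \o w) by apply/measurable_funU.
apply/integrableP; split => //.
rewrite -(setDUK (@subsetUl _ A B)) integral_setU//.
- apply: lte_add_pinfty => //; apply: le_lt_trans wB.
  apply: ge0_subset_integral => //.
  + by apply: measurableD => //; exact: measurableU.
  + exact: measurableT_comp.
  + by move=> x [[]].
- by apply: measurableD => //; exact: measurableU.
- by rewrite setDUK//; apply: measurableT_comp.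
- by apply/disj_set2P; rewrite setDIK.
Qed.

End IntegrableUnion.

Section ItvKernels.
Context {R : realType}.

Lemma measurable_lt_graph : measurable [set z : R * R | z.2 < z.1].
Proof.
rewrite (_ : [set _ | _] = setT `&` (fun z : R * R => z.2 < z.1) @^-1` [set true]).
  by apply: (measurable_fun_ltr measurable_snd measurable_fst).
by apply/seteqP; split => z /=; [split|case].
Qed.

Lemma measurable_fwd_graph (c : R) : measurable [set z : R * R | `[c, z.1[%classic z.2].
Proof.
rewrite (_ : [set _ | _] = (setT `*` `[c, +oo[%classic) `&` [set z | z.2 < z.1]).
  by apply: measurableI; [exact: measurableX|exact: measurable_lt_graph].
apply/seteqP; split => z /=; rewrite !in_itv/= ?andbT; first by case/andP.
by move=> [[_ ->] ->].
Qed.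

Lemma measurable_bwd_graph (c : R) : measurable [set z : R * R | `]z.1, c[%classic z.2].
Proof.
rewrite (_ : [set _ | _] = (setT `*` `]-oo, c[%classic) `&`
   (fun z : R * R => (z.2, z.1)) @^-1` [set z | z.2 < z.1]).
  apply: measurableI; first exact: measurableX.
  rewrite -[X in measurable X]setTI.
  exact: (measurable_swap measurableT measurable_lt_graph).
apply/seteqP; split => z /=; rewrite !in_itv/= ?andbT; first by case/andP.
by move=> [[_ ->] ->].
Qed.

Lemma fwd_trans (c x t s : R) : `[c, x[%classic t -> `[c, t[%classic s -> `[c, x[%classic s.
Proof.
rewrite /= !in_itv/= => /andP[_ tx] /andP[-> st] /=; exact: lt_trans tx.
Qed.

Lemma fwd_irr (c x : R) : ~ `[c, x[%classic x.
Proof. by rewrite /= in_itv/= ltxx andbF. Qed.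

Lemma fwd_total (c x s t : R) : `[c, x[%classic s -> `[c, x[%classic t ->
  [\/ `[c, s[%classic t, `[c, t[%classic s | s = t].
Proof.
rewrite /= !in_itv/= => /andP[-> _] /andP[-> _] /=.
by case: (ltgtP s t) => [?|?|->]; [constructor 2|constructor 1|constructor 3].
Qed.

Lemma bwd_trans (c x t s : R) : `]x, c[%classic t -> `]t, c[%classic s -> `]x, c[%classic s.
Proof.
rewrite /= !in_itv/= => /andP[xt _] /andP[ts ->]; rewrite andbT; exact: lt_trans ts.
Qed.

(** The reason for leaving out the lower end of the backward kernel: with [[x, c)] the point [x]
    would be its own predecessor. *)
Lemma bwd_irr (c x : R) : ~ `]x, c[%classic x.
Proof. by rewrite /= in_itv/= ltxx. Qed.

Lemma bwd_total (c x s t : R) : `]x, c[%classic s -> `]x, c[%classic t ->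
  [\/ `]s, c[%classic t, `]t, c[%classic s | s = t].
Proof.
rewrite /= !in_itv/= => /andP[_ ->] /andP[_ ->] /=; rewrite !andbT.
by case: (ltgtP s t) => [?|?|->]; [constructor 1|constructor 2|constructor 3].
Qed.

Lemma exists_between_right (d : R) (b : \bar R) : (d%:E < b)%E ->
  exists2 X : R, d < X & (X%:E < b)%E.
Proof.
case: b => [b||//] /=; rewrite ?lte_fin => db.
- by exists ((d + b) / 2); rewrite ?lte_fin; lra.
- by exists (d + 1); rewrite ?ltry//; lra.
Qed.

Lemma exists_between_left (d : R) (a : \bar R) : (a < d%:E)%E ->
  exists2 X : R, X < d & (a < X%:E)%E.
Proof.
case: a => [a|//|] /=; rewrite ?lte_fin => ad.
- by exists ((a + d) / 2); rewrite ?lte_fin; lra.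
- by exists (d - 1); rewrite ?ltNyr//; lra.
Qed.

End ItvKernels.

Section Primitive.
Context {R : realType} (mu : {sigma_finite_measure set R -> \bar R}) (a b : \bar R).
Hypothesis mufin : forall c d : R, (a < c%:E)%E -> (d%:E < b)%E ->
  (mu `[c, d]%classic < +oo)%E.
Implicit Types (G H w v : R -> R).

Definition locint w := forall c d : R, (a < c%:E)%E -> (d%:E < b)%E ->
  intg mu `[c, d]%classic w.

(** Stating all increments, rather than one formula from a base point, makes the notion independent
    of the base and stable under restriction to subintervals. The half-open intervals encode left
    continuity. *)
Definition primitive G w := locint w /\
  forall al be : R, (a < al%:E)%E -> al < be -> (be%:E < b)%E ->
    G be - G al = \int[mu]_(t in `[al, be[%classic) w t.

Lemma oi_itv (c d t : R) : (a < c%:E)%E -> (d%:E < b)%E -> `[c, d]%classic t -> oi a b t.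
Proof.
rewrite /= in_itv/= => ac db /andP[ct td]; split.
  by apply: lt_le_trans ac _; rewrite lee_fin.
by apply: le_lt_trans db; rewrite lee_fin.
Qed.

Lemma locint_subset w (c d : R) (A : set R) : locint w -> (a < c%:E)%E -> (d%:E < b)%E ->
  measurable A -> A `<=` `[c, d]%classic -> intg mu A w.
Proof. by move=> lw ac db mA AS; apply: integrableS (lw c d ac db). Qed.

Lemma locint_ico w (c d : R) : locint w -> (a < c%:E)%E -> (d%:E < b)%E ->
  intg mu `[c, d[%classic w.
Proof.
move=> lw ac db; apply: (locint_subset w c d) => //.
by apply: subset_itvl; rewrite bnd_simp.
Qed.

Lemma locint_ext w v : (forall t, oi a b t -> w t = v t) -> locint w -> locint v.
Proof.
move=> e lw c d ac db; apply: (eq_intg _ _ w) => //; last exact: lw.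
by move=> t tcd; apply: e; exact: oi_itv tcd.
Qed.

Lemma locintD w v : locint w -> locint v -> locint (fun t => w t + v t).
Proof. by move=> lw lv c d ac db; apply: intgD => //; [exact: lw|exact: lv]. Qed.

Lemma locintB w v : locint w -> locint v -> locint (fun t => w t - v t).
Proof. by move=> lw lv c d ac db; apply: intgB => //; [exact: lw|exact: lv]. Qed.

Lemma locintZ k w : locint w -> locint (fun t => k * w t).
Proof. by move=> lw c d ac db; apply: intgZ => //; exact: lw. Qed.

Lemma locintN w : locint w -> locint (fun t => - w t).
Proof. by move=> lw c d ac db; apply: intgN => //; exact: lw. Qed.

Lemma locint_mulb G w : (forall c d : R, (a < c%:E)%E -> (d%:E < b)%E ->
    measurable_fun `[c, d]%classic G /\
    exists C : R, forall t, `[c, d]%classic t -> `|G t| <= C) -> locint w ->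
  locint (fun t => G t * w t).
Proof.
move=> h lw c d ac db; have [mG [C GC]] := h c d ac db.
by apply: intgM GC _ => //; exact: lw.
Qed.

Lemma Rint_ico_split w (c t d : R) : c <= t -> t <= d -> intg mu `[c, d[%classic w ->
  \int[mu]_(s in `[c, d[%classic) w s =
  \int[mu]_(s in `[c, t[%classic) w s + \int[mu]_(s in `[t, d[%classic) w s.
Proof.
move=> ct td; apply: Rint_sub => //.
  apply/seteqP; split => s //=; rewrite !in_itv/= => -[/andP[_ st] /andP[ts _]].
  by have := lt_le_trans st ts; rewrite ltxx.
by rewrite -itv_bndbnd_setU ?bnd_simp.
Qed.

Lemma primitive_from_base G w (c : R) : oi a b c -> locint w ->
  (forall x, c < x -> (x%:E < b)%E -> G x = G c + \int[mu]_(t in `[c, x[%classic) w t) ->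
  (forall x, x < c -> (a < x%:E)%E -> G x = G c - \int[mu]_(t in `[x, c[%classic) w t) ->
  primitive G w.
Proof.
move=> [ac cb] lw up dn; split => // al be aal albe beb.
have ab_be : (a < be%:E)%E by apply: lt_trans aal _; rewrite lte_fin.
have al_b : (al%:E < b)%E by apply: lt_trans beb; rewrite lte_fin.
case: (ltgtP c al) => [cal|alc|cal].
- rewrite (up be)// ?(lt_trans cal)// (up al)//.
  rewrite (Rint_ico_split _ c al be) ?(ltW albe) ?(ltW cal)//; last exact: locint_ico.
  by ring.
- case: (ltgtP c be) => [cbe|bec|<-].
  + rewrite (up be)// (dn al)// (Rint_ico_split _ al c be) ?ltW//; first by ring.
    exact: locint_ico.
  + rewrite (dn be)// (dn al)// (Rint_ico_split _ al be c) ?ltW//; first by ring.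
    exact: locint_ico.
  + by rewrite (dn al)//; ring.
- by rewrite -cal in albe *; rewrite (up be)//; ring.
Qed.

Lemma primitive_fwd G w (c x : R) : primitive G w -> (a < c%:E)%E -> (x%:E < b)%E -> c <= x ->
  G x = G c + \int[mu]_(t in `[c, x[%classic) w t.
Proof.
move=> [_ e] ac xb; rewrite le_eqVlt => /predU1P[<-|cx].
  by rewrite set_itvco0 Rintegral_set0 addr0.
by rewrite -e// addrC subrK.
Qed.

Lemma primitive_measurable G w (c d : R) : primitive G w -> (a < c%:E)%E -> (d%:E < b)%E ->
  measurable_fun `[c, d]%classic G.
Proof.
(* The kernels are half-open, so a point [X] beyond [d] is needed to have all of [[c, d]] inside
   [[c, X)]. *)
move=> pG ac db; have [X dX Xb] := exists_between_right _ _ db.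
pose D x := (x%:E < b)%E.
have mI : measurable_fun `[c, X[%classic (fun t => \int[mu]_(s in `[c, t[%classic) w s).
  apply: (measurable_kernel_integral mu (fun x => `[c, x[%classic) (measurable_fwd_graph c)
    (fwd_trans c) (fwd_irr c) (fwd_total c) D) => //.
  - move=> x Dx; apply: le_lt_trans (mufin c x ac Dx); apply: le_measure; rewrite ?inE//.
    by apply: subset_itvl; rewrite bnd_simp.
  - exact: locint_ico pG.1 ac Xb.
have cdX : `[c, d]%classic `<=` `[c, X[%classic.
  by apply: subset_itvl; rewrite bnd_simp.
apply: (eq_measurable_fun (fun t => G c + \int[mu]_(s in `[c, t[%classic) w s)).
  move=> t /set_mem tcd; rewrite -(primitive_fwd G w)//.
    by have [] := oi_itv c d t ac db tcd.
  by move: tcd; rewrite /= in_itv/= => /andP[].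
by apply: measurable_funD => //; exact: measurable_funS cdX mI.
Qed.

Lemma primitive_bounded G w (c d : R) : primitive G w -> (a < c%:E)%E -> (d%:E < b)%E ->
  exists C : R, forall t, `[c, d]%classic t -> `|G t| <= C.
Proof.
move=> pG ac db; exists (`|G c| + \int[mu]_(t in `[c, d]%classic) `|w t|) => t tcd.
have [_ tb] := oi_itv c d t ac db tcd.
move: tcd; rewrite /= in_itv/= => /andP[ct td].
rewrite (primitive_fwd G w c t)//; apply: le_trans (ler_normD _ _) _.
rewrite lerD2l; apply: le_trans (le_normr_Rintegral _ _) _ => //.
  exact: locint_ico pG.1 ac tb.
apply: Rint_subset => //; last exact: pG.1.
by move=> s /=; rewrite !in_itv/= => /andP[-> st]; exact: ltW (lt_le_trans st td).
Qed.

Lemma locint_mul G v w : primitive G v -> locint w -> locint (fun t => G t * w t).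
Proof.
move=> pG; apply: locint_mulb => c d ac db; split.
  exact: primitive_measurable pG ac db.
exact: primitive_bounded pG ac db.
Qed.

Lemma primitive_ext G w v : (forall t, oi a b t -> w t = v t) ->
  primitive G w -> primitive G v.
Proof.
move=> e [lw pG]; split; first exact: locint_ext lw.
move=> al be aal albe beb; rewrite pG//; apply: eq_Rint => t.
move=> tI; apply: e; apply: (oi_itv al be) => //.
by move: t tI; apply: subset_itvl; rewrite bnd_simp.
Qed.

Lemma primitiveD G H w v : primitive G w -> primitive H v ->
  primitive (fun t => G t + H t) (fun t => w t + v t).
Proof.
move=> [lw pG] [lv pH]; split; first exact: locintD.
move=> al be aal albe beb; rewrite RintegralD//; try exact: locint_ico.
by rewrite -pG// -pH//; ring.
Qed.

Lemma primitiveZ k G w : primitive G w ->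
  primitive (fun t => k * G t) (fun t => k * w t).
Proof.
move=> [lw pG]; split; first exact: locintZ.
move=> al be aal albe beb; rewrite RintegralZl//; last exact: locint_ico.
by rewrite -pG//; ring.
Qed.

Lemma primitiveB G H w v : primitive G w -> primitive H v ->
  primitive (fun t => G t - H t) (fun t => w t - v t).
Proof.
move=> pG pH; have := primitiveD _ _ _ _ pG (primitiveZ (-1) _ _ pH).
have -> : (fun t => w t + -1 * v t) = (fun t => w t - v t).
  by apply/funext => t; rewrite mulN1r.
by have -> : (fun t => G t + -1 * H t) = (fun t => G t - H t);
  first by apply/funext => t; rewrite mulN1r.
Qed.

(** In the density [G] and [H] are taken at their left limits. At an atom the product jumps by [H]
    times the jump of [G], [G] times the jump of [H], and the product of both jumps; the last gives
    the [atom] term. *)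
Lemma primitiveM G H w v : primitive G w -> primitive H v ->
  primitive (fun t => G t * H t)
    (fun t => w t * H t + v t * G t + w t * v t * atom mu t).
Proof.
move=> pG pH.
have core (c X : R) : (a < c%:E)%E -> (X%:E < b)%E -> c <= X ->
    intg mu `[c, X[%classic (fun t => w t * v t * atom mu t) /\
    G X * H X - G c * H c = \int[mu]_(t in `[c, X[%classic)
      (w t * H t + v t * G t + w t * v t * atom mu t).
  move=> ac Xb cX.
  have fin : (mu `[c, X[%classic < +oo)%E.
    apply: le_lt_trans (mufin c X ac Xb); apply: le_measure; rewrite ?inE//.
    by apply: subset_itvl; rewrite bnd_simp.
  have iw := locint_ico _ _ _ pG.1 ac Xb.
  have iv := locint_ico _ _ _ pH.1 ac Xb.
  have [i1 i2 i3 e] := kernel_product_rule mu (fun x => `[c, x[%classic)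
    (measurable_fwd_graph c) (fwd_trans c) (fwd_irr c) (fwd_total c) X w v fin iw iv.
  split => //.
  (* Writing [G] and [H] as base value plus increment isolates the integrand of the kernel product
     rule; the base values contribute only terms linear in [w] and [v]. *)
  rewrite (eq_Rint _ _ _ (fun t => (w t * \int[mu]_(s in `[c, t[%classic) v s +
      v t * \int[mu]_(s in `[c, t[%classic) w s + w t * v t * atom mu t) +
      (H c * w t + G c * v t))); last first.
    move=> t tcX.
    have [|_ tb] := oi_itv c X t ac Xb.
      by move: t tcX; apply: subset_itvl; rewrite bnd_simp.
    have ct : c <= t by move: tcX; rewrite /= in_itv/= => /andP[].
    by rewrite (primitive_fwd G w c t)// (primitive_fwd H v c t)//; ring.
  rewrite RintegralD//; first last.
  - by apply: intgD => //; exact: intgZ.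
  - by apply: intgD => //; exact: intgD.
  rewrite -e RintegralD//; try exact: intgZ.
  rewrite !RintegralZl//.
  by rewrite (primitive_fwd G w c X)// (primitive_fwd H v c X)//; ring.
split; last by move=> al be aal albe beb; have [_ ->] := core al be aal beb (ltW albe).
apply: locintD; first apply: locintD.
- apply: (locint_ext (fun t => H t * w t)); first by move=> t _; rewrite mulrC.
  exact: locint_mul pH pG.1.
- apply: (locint_ext (fun t => G t * v t)); first by move=> t _; rewrite mulrC.
  exact: locint_mul pG pH.1.
- move=> c d ac db; have [dc|cd] := ltP d c.
    by rewrite set_itv_ge ?bnd_simp -?ltNge//; exact: integrable_set0.
  have [X dX Xb] := exists_between_right _ _ db.
  have [i _] := core c X ac Xb (le_trans cd (ltW dX)).
  apply: integrableS i => //.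
  by apply: subset_itvl; rewrite bnd_simp.
Qed.

End Primitive.

(** * The first-order system *)

Section Equation.
Context {R : realType} (mu : {sigma_finite_measure set R -> \bar R}) (a b : \bar R).
Hypothesis mufin : forall c d : R, (a < c%:E)%E -> (d%:E < b)%E ->
  (mu `[c, d]%classic < +oo)%E.
Variables (s x : R -> R).
Hypothesis ls : locint mu a b s.
Hypothesis lx : locint mu a b x.
Hypothesis sx0 : forall t, oi a b t -> s t * x t * atom mu t = 0.
Implicit Types (f q k u p l : R -> R).

(* The first-order form of [tau f = g]: [q] is the quasi-derivative with
   [df = q dsigma], [dq = f dchi - g drho], and [k = g r]. *)
Definition solution f q k :=
  primitive mu a b f (fun t => q t * s t) /\
  primitive mu a b q (fun t => f t * x t - k t).

(** (H4) for the source term. It kills the products of jumps in Lagrange's identity and the implicit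
    terms in the initial value problem to the left. *)
Definition compatible k := locint mu a b k /\
  forall t, oi a b t -> s t * k t * atom mu t = 0.

(** In the difference of the two products the terms with [q p s] and with [f u x] cancel. The
    products of jumps contain [s x], [s k] or [s l] times an atom and vanish one by one. *)
Lemma lagrange f q k u p l : compatible k -> compatible l ->
  solution f q k -> solution u p l ->
  primitive mu a b (fun t => f t * p t - u t * q t) (fun t => u t * k t - f t * l t).
Proof.
move=> [_ k0] [_ l0] [pf pq] [pu pp].
apply: primitive_ext (primitiveB _ _ _ _ _ _ _
  (primitiveM _ _ _ mufin _ _ _ _ pf pp) (primitiveM _ _ _ mufin _ _ _ _ pu pq)).
move=> t abt /=; have sx := sx0 t abt; have sk := k0 t abt; have sl := l0 t abt.
have -> : q t * s t * (u t * x t - l t) * atom mu t =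
    q t * u t * (s t * x t * atom mu t) - q t * (s t * l t * atom mu t) by ring.
have -> : p t * s t * (f t * x t - k t) * atom mu t =
    p t * f t * (s t * x t * atom mu t) - p t * (s t * k t * atom mu t) by ring.
by rewrite sx sk sl; ring.
Qed.

Lemma solutionD f q k u p l : solution f q k -> solution u p l ->
  solution (fun t => f t + u t) (fun t => q t + p t) (fun t => k t + l t).
Proof.
move=> [pf pq] [pu pp]; split.
  by apply: primitive_ext (primitiveD _ _ _ _ _ _ _ pf pu) => t _ /=; ring.
by apply: primitive_ext (primitiveD _ _ _ _ _ _ _ pq pp) => t _ /=; ring.
Qed.

Lemma solutionZ c f q k : solution f q k ->
  solution (fun t => c * f t) (fun t => c * q t) (fun t => c * k t).
Proof.
move=> [pf pq]; split.
  by apply: primitive_ext (primitiveZ _ _ _ c _ _ pf) => t _ /=; ring.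
by apply: primitive_ext (primitiveZ _ _ _ c _ _ pq) => t _ /=; ring.
Qed.

Let glue_locint (c : R) w : oi a b c ->
  (forall X : R, (a < X%:E)%E -> intg mu `]X, c[%classic w) ->
  (forall Y : R, (Y%:E < b)%E -> intg mu `[c, Y[%classic w) -> locint mu a b w.
Proof.
move=> [ac cb] iX iY c1 d1 ac1 d1b.
have [X Xc1 aX] := exists_between_left _ _ ac1.
have [Y d1Y Yb] := exists_between_right _ _ d1b.
apply: (@integrableS _ _ _ _ (`]X, c[%classic `|` `[c, Y[%classic)) => //.
- exact: measurableU.
- move=> t /=; rewrite !in_itv/= => /andP[c1t td1].
  by have [tc|ct] := ltP t c; [left; rewrite (lt_le_trans Xc1)|right; rewrite (le_lt_trans td1)].
- by apply: intg_setU => //; [exact: iX|exact: iY].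
Qed.

(* To the left of the base point an atom at the lower end of [[x, c)] makes the
   equation implicit, so it is first solved with [(x, c)] in place of [[x, c)],
   which yields right limits; one step across the atom then gives the solution,
   because [s x] and [s k] vanish at atoms. *)
Lemma solution_exists (c y1 y2 : R) k : oi a b c -> compatible k ->
  exists f q, [/\ solution f q k, f c = y1 & q c = y2].
Proof.
move=> abc [lk sk0]; have [ac cb] := abc.
have fin1 t : oi a b t -> (mu [set t] < +oo)%E.
  by move=> [at_ tb]; rewrite -set_itv1; exact: mufin.
have [zf1 [zf2 zf]] : exists z1 z2 : R -> R, forall X : R, (X%:E < b)%E ->
    [/\ intg mu `[c, X[%classic (fun t => z1 t * x t),
        intg mu `[c, X[%classic (fun t => z2 t * s t),
        z1 X = y1 + \int[mu]_(t in `[c, X[%classic) (z2 t * s t) &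
        z2 X = y2 + \int[mu]_(t in `[c, X[%classic) (z1 t * x t - k t)].
  apply: (volterra_system mu (fun X => `[c, X[%classic) (measurable_fwd_graph c)
    (fwd_trans c) (fwd_irr c) (fwd_total c) (fun X => (X%:E < b)%E)).
  - move=> X t Xb; rewrite /= in_itv/= => /andP[_ tX].
    by apply: lt_trans Xb; rewrite lte_fin.
  - move=> X Xb; apply: le_lt_trans (mufin c X ac Xb); apply: le_measure; rewrite ?inE//.
    by apply: subset_itvl; rewrite bnd_simp.
  - by move=> X Xb; exact: locint_ico ls ac Xb.
  - by move=> X Xb; exact: locint_ico lx ac Xb.
  - by move=> X Xb; exact: locint_ico lk ac Xb.
have sub_oo (X : R) : `]X, c[%classic `<=` `[X, c]%classic.
  by apply: subset_itvScc; rewrite bnd_simp.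
have loc_oo w (X : R) : locint mu a b w -> (a < X%:E)%E -> intg mu `]X, c[%classic w.
  by move=> lw aX; apply: (locint_subset mu a b w X c _ lw aX cb _ (sub_oo X)).
(* The signs turn integrals over [(X, c)] into oriented ones; [zb1] and [zb2] are the right limits
   of the solution to be built. *)
have [zb1 [zb2 zb]] : exists z1 z2 : R -> R, forall X : R, (a < X%:E)%E ->
    [/\ intg mu `]X, c[%classic (fun t => z1 t * - x t),
        intg mu `]X, c[%classic (fun t => z2 t * - s t),
        z1 X = y1 + \int[mu]_(t in `]X, c[%classic) (z2 t * - s t) &
        z2 X = y2 + \int[mu]_(t in `]X, c[%classic) (z1 t * - x t - - k t)].
  apply: (volterra_system mu (fun X => `]X, c[%classic) (measurable_bwd_graph c)
    (fun X => bwd_trans c X) (bwd_irr c) (bwd_total c) (fun X => (a < X%:E)%E)).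
  - move=> X t aX; rewrite /= in_itv/= => /andP[Xt _].
    by apply: lt_trans aX _; rewrite lte_fin.
  - by move=> X aX; apply: le_lt_trans (mufin X c aX cb); apply: le_measure; rewrite ?inE//; exact: sub_oo.
  - by move=> X aX; apply: loc_oo => //; exact: locintN.
  - by move=> X aX; apply: loc_oo => //; exact: locintN.
  - by move=> X aX; apply: loc_oo => //; exact: locintN.
(* Left of [c] the jump at [t] is subtracted from the right limit. The jump is computed with right
   limits in place of the unknown values at [t]; [bq] and [bf] below show that the integrands are
   the same for both. *)
pose f t := if c <= t then zf1 t else zb1 t - s t * zb2 t * atom mu t.
pose q t := if c <= t then zf2 t else zb2 t - (x t * zb1 t - k t) * atom mu t.
have fwd t : c <= t -> f t = zf1 t /\ q t = zf2 t by rewrite /f /q => ->.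
have bwd t : t < c -> f t = zb1 t - s t * zb2 t * atom mu t /\
    q t = zb2 t - (x t * zb1 t - k t) * atom mu t.
  by rewrite /f /q ltNge => /negbTE ->.
have oic t : (a < t%:E)%E -> t < c -> oi a b t.
  by move=> at_ tc; split => //; apply: lt_trans cb; rewrite lte_fin.
have bq t : (a < t%:E)%E -> t < c -> q t * s t = - (zb2 t * - s t).
  move=> at_ tc; have [_ ->] := bwd t tc; have abt := oic t at_ tc.
  have -> : (zb2 t - (x t * zb1 t - k t) * atom mu t) * s t =
    zb2 t * s t - zb1 t * (s t * x t * atom mu t) + s t * k t * atom mu t by ring.
  by rewrite sx0// sk0//; ring.
have bf t : (a < t%:E)%E -> t < c -> f t * x t = - (zb1 t * - x t).
  move=> at_ tc; have [-> _] := bwd t tc; have abt := oic t at_ tc.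
  have -> : (zb1 t - s t * zb2 t * atom mu t) * x t =
    zb1 t * x t - zb2 t * (s t * x t * atom mu t) by ring.
  by rewrite sx0//; ring.
have itvP X t : (a < X%:E)%E -> `]X, c[%classic t -> (a < t%:E)%E /\ t < c.
  rewrite /= in_itv/= => aX /andP[Xt ->]; split => //.
  by apply: lt_trans aX _; rewrite lte_fin.
have fwdP Y t : `[c, Y[%classic t -> c <= t by rewrite /= in_itv/= => /andP[].
have lq : locint mu a b (fun t => q t * s t).
  apply: (glue_locint c) => //.
    move=> X aX; apply: (eq_intg _ _ (fun t => - (zb2 t * - s t))) => //.
      by move=> t /(itvP _ _ aX)[at_ tc]; rewrite bq.
    by apply: intgN => //; have [] := zb X aX.
  move=> Y Yb; apply: (eq_intg _ _ (fun t => zf2 t * s t)) => //.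
    by move=> t /fwdP/fwd[_ ->].
  by have [] := zf Y Yb.
have lf : locint mu a b (fun t => f t * x t).
  apply: (glue_locint c) => //.
    move=> X aX; apply: (eq_intg _ _ (fun t => - (zb1 t * - x t))) => //.
      by move=> t /(itvP _ _ aX)[at_ tc]; rewrite bf.
    by apply: intgN => //; have [] := zb X aX.
  move=> Y Yb; apply: (eq_intg _ _ (fun t => zf1 t * x t)) => //.
    by move=> t /fwdP/fwd[-> _].
  by have [] := zf Y Yb.
have lfk : locint mu a b (fun t => f t * x t - k t) by exact: locintB.
have [fc qc] : f c = y1 /\ q c = y2.
  have [-> ->] := fwd c (lexx c); have [_ _ -> ->] := zf c cb.
  by rewrite set_itvco0 !Rintegral_set0 !addr0.
have split_left w X : locint mu a b w -> (a < X%:E)%E -> X < c ->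
    \int[mu]_(t in `[X, c[%classic) w t =
    w X * atom mu X + \int[mu]_(t in `]X, c[%classic) w t.
  move=> lw aX Xc; rewrite (Rint_sub mu [set X] `]X, c[%classic)//.
  - by rewrite Rint_set1//; apply: fin1; exact: oic.
  - by apply/seteqP; split => t //= [->]; rewrite in_itv/= ltxx.
  - apply/seteqP; split => t /=; rewrite !in_itv/=.
      by move=> [->|/andP[/ltW -> ->]//]; rewrite lexx.
    by move=> /andP[]; rewrite le_eqVlt => /predU1P[->|-> ->]; [left|right].
  - exact: locint_ico lw aX cb.
exists f, q; split => //; split; apply: (primitive_from_base _ _ _ _ _ c) => //.
- move=> X cX Xb; have [-> _] := fwd X (ltW cX); have [_ _ -> _] := zf X Xb.
  by rewrite fc; congr (_ + _); apply: eq_Rint => t /fwdP/fwd[_ ->].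
- move=> X Xc aX; rewrite split_left// fc bq//.
  have [-> _] := bwd X Xc; have [_ i2 -> _] := zb X aX.
  rewrite (eq_Rint mu _ (fun t => q t * s t) (fun t => -1 * (zb2 t * - s t))).
    by rewrite RintegralZl//; ring.
  by move=> t /(itvP _ _ aX)[at_ tc]; rewrite bq// mulN1r.
- move=> X cX Xb; have [_ ->] := fwd X (ltW cX); have [_ _ _ ->] := zf X Xb.
  by rewrite qc; congr (_ + _); apply: eq_Rint => t /fwdP/fwd[-> _].
- move=> X Xc aX; rewrite split_left// qc bf//.
  have [_ ->] := bwd X Xc; have [i1 _ _ ->] := zb X aX.
  rewrite (eq_Rint mu _ (fun t => f t * x t - k t) (fun t => -1 * (zb1 t * - x t - - k t))).
    rewrite RintegralZl//; first by ring.
    by apply: intgB => //; apply: loc_oo => //; exact: locintN.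
  by move=> t /(itvP _ _ aX)[at_ tc]; rewrite bf//; ring.
Qed.

End Equation.

(** * Functionals that vanish on a common kernel *)

Section LinearFunctionals.
Context {K : fieldType} {V : lmodType K}.
Implicit Types (P : V -> Prop) (l : V -> K).

Definition linear_on P l := forall c u v, P u -> P v -> l (u + c *: v) = l u + c * l v.
Definition combination_closed P := forall c u v, P u -> P v -> P (u + c *: v).

Lemma functional_multiple P l l1 :
  combination_closed P -> linear_on P l -> linear_on P l1 ->
  (forall v, P v -> l1 v = 0 -> l v = 0) ->
  exists c, forall v, P v -> l v = c * l1 v.
Proof.
move=> cP ll ll1 ker.
have [[v0 [Pv0 /eqP l10]]|no] := pselect (exists v0, P v0 /\ l1 v0 <> 0).
  (* The vector [v - (l1 v / l1 v0) *: v0] lies in the kernel of [l1]. *)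
  exists (l v0 / l1 v0) => v Pv.
  have := ker _ (cP (- (l1 v / l1 v0)) _ _ Pv Pv0).
  rewrite ll1// ll// mulNr divfK// subrr => /(_ erefl)/eqP.
  rewrite mulNr subr_eq0 => /eqP ->; rewrite mulrAC [RHS]mulrAC.
  by congr (_ / _); rewrite mulrC.
exists 0 => v Pv; rewrite mul0r; apply: ker => //.
by apply: contra_notP no => nz; exists v.
Qed.

(** On the kernel of [l1], [l] is a multiple of [l2]. Subtracting this multiple leaves a functional
    that vanishes on that kernel, hence a multiple of [l1]. *)
Lemma functional_combination P l l1 l2 :
  combination_closed P -> linear_on P l -> linear_on P l1 -> linear_on P l2 ->
  (forall v, P v -> l1 v = 0 -> l2 v = 0 -> l v = 0) ->
  exists c1 c2, forall v, P v -> l v = c1 * l1 v + c2 * l2 v.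
Proof.
move=> cP ll ll1 ll2 ker.
pose Q v := P v /\ l1 v = 0.
have cQ : combination_closed Q.
  move=> c u v [Pu u0] [Pv v0]; split; first exact: cP.
  by rewrite ll1// u0 v0 mulr0 addr0.
have [c2 h2] : exists c, forall v, Q v -> l v = c * l2 v.
  apply: functional_multiple => //.
  - by move=> c u v [Pu _] [Pv _]; exact: ll.
  - by move=> c u v [Pu _] [Pv _]; exact: ll2.
  - by move=> v [Pv v0]; exact: ker.
have [c1 h1] : exists c, forall v, P v -> l v - c2 * l2 v = c * l1 v.
  apply: (functional_multiple P (fun v => l v - c2 * l2 v)) => //.
  - by move=> c u v Pu Pv; rewrite ll// ll2//; ring.
  - by move=> v Pv v0; rewrite h2// subrr.
by exists c1, c2 => v Pv; rewrite -h1// subrK.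
Qed.

End LinearFunctionals.

Section Support.
Context {d} {T : measurableType d} {R : realType} (mu : {measure set T -> \bar R}).

Lemma Rint_support (A B : set T) (h : T -> R) : A `<=` B ->
  (forall t, B t -> ~ A t -> h t = 0) -> \int[mu]_(t in B) h t = \int[mu]_(t in A) h t.
Proof.
move=> AB h0; rewrite Rintegral_mkcond [RHS]Rintegral_mkcond.
apply: eq_Rint => t _; rewrite !patchE.
case: ifPn => [/set_mem Bt|/negP Bt]; case: ifPn => [/set_mem At|/negP At] //.
- by apply: h0 => // At'; apply: At; rewrite inE.
- by case: Bt; rewrite inE; exact: AB.
Qed.

Lemma intg_support (A : set T) (h : T -> R) : measurable A ->
  (forall t, ~ A t -> h t = 0) -> intg mu A h -> intg mu setT h.
Proof.
move=> mA h0 /(integrable_mkcond _ mA); apply: eq_integrable => // t _.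
rewrite patchE; case: ifPn => // /negP At /=; rewrite h0// => At'.
by apply: At; rewrite inE.
Qed.

End Support.

(** * Compactly supported solutions and the adjoint relation *)

Section MaximalOperator.
Context {R : realType} (mu : {sigma_finite_measure set R -> \bar R}) (a b : \bar R).
Hypothesis mufin : forall c d : R, (a < c%:E)%E -> (d%:E < b)%E ->
  (mu `[c, d]%classic < +oo)%E.
Variables (s x r : R -> R).
Hypothesis ls : locint mu a b s.
Hypothesis lx : locint mu a b x.
Hypothesis lr : locint mu a b r.
Hypothesis sx0 : forall t, oi a b t -> s t * x t * atom mu t = 0.
Hypothesis sr0 : forall t, oi a b t -> s t * r t * atom mu t = 0.
Hypothesis ab : exists c, oi a b c.

Local Notation solution := (solution mu a b s x).

Lemma compatible_weight g : locint mu a b (fun t => g t * r t) ->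
  compatible mu a b s (fun t => g t * r t).
Proof.
move=> lg; split => // t abt.
have -> : s t * (g t * r t) * atom mu t = g t * (s t * r t * atom mu t) by ring.
by rewrite sr0// mulr0.
Qed.

Lemma compatible0 : compatible mu a b s (fun=> 0).
Proof.
split; first by move=> c d ac db; exact: intg0.
by move=> t _; rewrite mulr0 mul0r.
Qed.

Definition supported (c d : R) (w : R -> R) := forall t, ~ `[c, d]%classic t -> w t = 0.

(** Bounded, so that the pairing is finite with every locally integrable [h r]; and containing the
    indicators of Borel subsets of [[c, d]], so that it detects functions almost everywhere. *)
Definition test_function (w : R -> R) := [/\ measurable_fun setT w,
  exists C : R, forall t, `|w t| <= C &
  exists c d : R, [/\ (a < c%:E)%E, (d%:E < b)%E & supported c d w]].

Lemma supported_subset (c d c' d' : R) w : c' <= c -> d <= d' ->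
  supported c d w -> supported c' d' w.
Proof.
move=> cc dd sw t nt; apply: sw => tcd; apply: nt; move: tcd.
by rewrite /= !in_itv/= => /andP[/(le_trans cc) -> /le_trans ->].
Qed.

Lemma test_function_closed : combination_closed (test_function : (R -> R) -> Prop).
Proof.
move=> k u v [mu_ [C1 h1] [c1 [d1 [ac1 d1b s1]]]] [mv [C2 h2] [c2 [d2 [ac2 d2b s2]]]].
split.
- by apply: measurable_funD => //; exact: measurable_funM.
- exists (C1 + `|k| * C2) => t; apply: le_trans (ler_normD _ _) _.
  by rewrite lerD// normrM ler_wpM2l.
- exists (Num.min c1 c2), (Num.max d1 d2); split.
  + by rewrite /Num.min; case: ifP.
  + by rewrite /Num.max; case: ifP.
  + move=> t nt.
    rewrite (_ : (u + k *: v) t = u t + k * v t)//.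
    rewrite (supported_subset c1 d1 (Num.min c1 c2) (Num.max d1 d2) u)//; last 2 first.
    * by rewrite ge_min lexx.
    * by rewrite le_max lexx.
    rewrite (supported_subset c2 d2 (Num.min c1 c2) (Num.max d1 d2) v) ?mulr0 ?addr0//.
    * by rewrite ge_min lexx orbT.
    * by rewrite le_max lexx orbT.
Qed.

Lemma test_locint h w : locint mu a b (fun t => h t * r t) -> test_function w ->
  locint mu a b (fun t => h t * w t * r t).
Proof.
move=> lh [mw [C hC] _] c d ac db.
apply: (eq_intg _ _ (fun t => w t * (h t * r t))) => //; first by move=> t _; ring.
by apply: (intgM _ _ C) => //; [exact: measurable_funTS|exact: lh].
Qed.

Lemma test_integrable h w : locint mu a b (fun t => h t * r t) -> test_function w ->
  intg mu setT (fun t => h t * w t * r t).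
Proof.
move=> lh tw; have lw := test_locint h w lh tw.
have [_ _ [c [d [ac db sw]]]] := tw.
apply: (intg_support mu `[c, d]%classic) => //; last exact: lw.
by move=> t nt; rewrite sw// mulr0 mul0r.
Qed.

Definition pairing (h w : R -> R) := \int[mu]_t (h t * w t * r t).

Lemma pairing_linear h : locint mu a b (fun t => h t * r t) ->
  linear_on (test_function : (R -> R) -> Prop) (pairing h).
Proof.
move=> lh k u v tu tv; rewrite /pairing -RintegralZl//; last exact: test_integrable.
rewrite -RintegralD//; first 1 last.
- exact: test_integrable.
- by apply: intgZ => //; exact: test_integrable.
apply: eq_Rint => t _; rewrite (_ : (u + k *: v) t = u t + k * v t)//; ring.
Qed.

Lemma pairing_itv h w (c d : R) (A : set R) : supported c d w -> `[c, d]%classic `<=` A ->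
  pairing h w = \int[mu]_(t in A) (h t * w t * r t).
Proof.
move=> sw cdA; rewrite /pairing [LHS](Rint_support mu A)//.
by move=> t _ nA; rewrite sw ?mulr0 ?mul0r// => /cdA.
Qed.

Lemma primitive_eq G G' w : (forall t, oi a b t -> G t = G' t) ->
  primitive mu a b G w -> primitive mu a b G' w.
Proof.
move=> e [lw pG]; split => // al be aal albe beb; rewrite -!e//; first exact: pG.
  by split => //; apply: lt_trans beb; rewrite lte_fin.
by split => //; apply: lt_trans aal _; rewrite lte_fin.
Qed.

Lemma solution_eq f f' q k k' : (forall t, oi a b t -> f t = f' t) ->
  (forall t, oi a b t -> k t = k' t) -> solution f q k -> solution f' q k'.
Proof.
move=> ef ek [pf pq]; split; first exact: primitive_eq pf.
by apply: primitive_ext pq => t abt; rewrite ef// ek.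
Qed.

(** By Lagrange's identity with zero sources the Wronskian is constant; the initial data [(1, 0)]
    and [(0, 1)] at [c] give it the value 1. *)
Lemma fundamental_system : exists u1 p1 u2 p2 : R -> R,
  [/\ solution u1 p1 (fun=> 0), solution u2 p2 (fun=> 0) &
    forall t, oi a b t -> u1 t * p2 t - u2 t * p1 t = 1].
Proof.
have [c abc] := ab.
have [u1 [p1 [s1 u1c p1c]]] := solution_exists mu a b mufin s x ls lx sx0 c 1 0 _ abc compatible0.
have [u2 [p2 [s2 u2c p2c]]] := solution_exists mu a b mufin s x ls lx sx0 c 0 1 _ abc compatible0.
exists u1, p1, u2, p2; split => // t abt.
have [_ W] := lagrange mu a b mufin s x sx0 _ _ _ _ _ _ compatible0 compatible0 s1 s2.
have W0 al be : (a < al%:E)%E -> al < be -> (be%:E < b)%E ->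
    u1 be * p2 be - u2 be * p1 be = u1 al * p2 al - u2 al * p1 al.
  move=> aal albe beb; apply/eqP; rewrite -subr_eq0 W//.
  rewrite (eq_Rint _ _ _ (fun=> 0)); first by rewrite Rintegral_cst// mul0r.
  by move=> y _; rewrite !mulr0 subrr.
have Wc : u1 c * p2 c - u2 c * p1 c = 1 by rewrite u1c u2c p1c p2c; ring.
case: abc abt => ac cb [at_ tb].
by case: (ltgtP c t) => [ct|tc|<-//]; [rewrite (W0 c t)|rewrite -(W0 t c)].
Qed.

(* The Wronskians of a solution with the fundamental system determine it, so a
   solution vanishing to the left of the support of [w] also vanishes to its
   right as soon as [w] is orthogonal to [u1] and [u2]. *)
Lemma compact_solution u1 p1 u2 p2 w :
  solution u1 p1 (fun=> 0) -> solution u2 p2 (fun=> 0) ->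
  (forall t, oi a b t -> u1 t * p2 t - u2 t * p1 t = 1) ->
  test_function w -> pairing u1 w = 0 -> pairing u2 w = 0 ->
  exists u p (c d : R), [/\ (a < c%:E)%E, (d%:E < b)%E, solution u p (fun t => w t * r t),
    supported c d w & forall t, oi a b t -> ~ `[c, d]%classic t -> u t = 0 /\ p t = 0].
Proof.
move=> s1 s2 W tw w1 w2; have [mw [C hC] [c [d [ac db sw]]]] := tw.
have [c0 [ac0 c0b]] := ab.
(* Staying left of [c0] as well keeps [X] in the interval even if [[c, d]] is empty and [c] lies
   beyond [b]. *)
have [X Xc aX] : exists2 X : R, X < Num.min c c0 & (a < X%:E)%E.
  by apply: exists_between_left; rewrite /Num.min; case: ifP.
have abX : oi a b X.
  by split => //; apply: lt_trans c0b; rewrite lte_fin (lt_le_trans Xc)// ge_min lexx orbT.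
have {}Xc : X < c by rewrite (lt_le_trans Xc)// ge_min lexx.
have lw : locint mu a b (fun t => w t * r t).
  apply: locint_ext (test_locint (fun=> 1) w _ tw); first by move=> t _; rewrite mul1r.
  by apply: locint_ext lr => t _; rewrite mul1r.
have cw := compatible_weight _ lw.
have [u [p [su uX pX]]] := solution_exists mu a b mufin s x ls lx sx0 X 0 0 _ abX cw.
exists u, p, c, d; split => // t abt nt.
(* The Wronskian of [u] and [v] is 0 at [X] and changes by integrals of [v w r]. Outside [[c, d]] it
   has collected either nothing or the whole pairing, which is 0. *)
have wr v q : solution v q (fun=> 0) -> pairing v w = 0 -> u t * q t - v t * p t = 0.
  move=> sv vw; have [lW pW] := lagrange mu a b mufin s x sx0 _ _ _ _ _ _ cw compatible0 su sv.
  case: abt => at_ tb.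
  have eI (A : set R) : \int[mu]_(y in A) (v y * (w y * r y) - u y * 0) =
      \int[mu]_(y in A) (v y * w y * r y).
    by apply: eq_Rint => y _; ring.
  have zero (A : set R) : (forall y, A y -> ~ `[c, d]%classic y) ->
      \int[mu]_(y in A) (v y * w y * r y) = 0.
    move=> nA; rewrite (eq_Rint _ _ _ (fun=> 0)); first by rewrite /Rintegral integral0.
    by move=> y /nA/sw ->; rewrite mulr0 mul0r.
  case: (ltgtP X t) => [Xt|tX|<-]; last by rewrite uX pX; ring.
  - have := pW _ _ aX Xt tb; rewrite uX pX !mul0r mulr0 subrr subr0 eI => ->.
    move: nt; rewrite /= in_itv/= => /negP; rewrite negb_and -!ltNge => /orP[tc|dt].
      by apply: zero => y; rewrite /= !in_itv/= => /andP[_ yt]; rewrite leNgt (lt_trans yt).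
    rewrite -(pairing_itv v w c d)//.
    move=> y; rewrite /= !in_itv/= => /andP[cy yd].
    by rewrite (le_trans (ltW Xc) cy) (le_lt_trans yd).
  - have := pW _ _ at_ tX abX.2; rewrite uX pX !mul0r mulr0 subrr sub0r eI zero.
      by move/eqP; rewrite oppr_eq0 => /eqP.
    by move=> y; rewrite /= !in_itv/= => /andP[_ yX]; rewrite leNgt (lt_trans yX).
(* Cramer's rule: both Wronskians vanish and the determinant of the system is 1. *)
have := wr _ _ s1 w1; have := wr _ _ s2 w2; have := W t abt.
move=> Wt /eqP; rewrite subr_eq0 => /eqP e2 /eqP; rewrite subr_eq0 => /eqP e1.
split.
  rewrite -[LHS]mulr1 -Wt mulrBr.
  rewrite (_ : u t * (u1 t * p2 t) = u1 t * (u t * p2 t)); last by ring.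
  rewrite (_ : u t * (u2 t * p1 t) = u2 t * (u t * p1 t)); last by ring.
  by rewrite e1 e2; ring.
rewrite -[LHS]mulr1 -Wt mulrBr.
rewrite (_ : p t * (u1 t * p2 t) = u1 t * p t * p2 t); last by ring.
rewrite (_ : p t * (u2 t * p1 t) = u2 t * p t * p1 t); last by ring.
by rewrite -e1 -e2; ring.
Qed.

(** By Lagrange's identity a particular solution [F0] satisfies the relation assumed of [f]. Thus
    pairing with [f - F0] kills each test function orthogonal to [u1] and [u2], and the coefficients
    of the resulting combination correct [F0] to [F]. *)
Lemma adjoint_solution f g :
  locint mu a b (fun t => f t * r t) -> locint mu a b (fun t => g t * r t) ->
  (forall u p w (c d : R), (a < c%:E)%E -> (d%:E < b)%E -> test_function w ->
    solution u p (fun t => w t * r t) -> supported c d u -> supported c d w ->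
    \int[mu]_(t in `[c, d]%classic) (f t * w t * r t) =
    \int[mu]_(t in `[c, d]%classic) (g t * u t * r t)) ->
  exists F q, solution F q (fun t => g t * r t) /\
    forall c d : R, (a < c%:E)%E -> (d%:E < b)%E ->
      ae_eq mu `[c, d]%classic (fun t => ((f t - F t) * r t)%:E) (cst 0%E).
Proof.
move=> lf lg adj; have [c0 abc0] := ab.
have cg := compatible_weight _ lg.
have [F0 [q0 [sF _ _]]] := solution_exists mu a b mufin s x ls lx sx0 c0 0 0 _ abc0 cg.
have [u1 [p1 [u2 [p2 [s1 s2 W]]]]] := fundamental_system.
have lF : locint mu a b (fun t => F0 t * r t) := locint_mul _ _ _ mufin _ _ _ sF.1 lr.
have l1 : locint mu a b (fun t => u1 t * r t) := locint_mul _ _ _ mufin _ _ _ s1.1 lr.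
have l2 : locint mu a b (fun t => u2 t * r t) := locint_mul _ _ _ mufin _ _ _ s2.1 lr.
have lfF : locint mu a b (fun t => (f t - F0 t) * r t).
  by apply: locint_ext (locintB _ _ _ _ _ lf lF) => t _; rewrite mulrBl.
have [c1 [c2 h]] : exists c1 c2, forall w, test_function w ->
    pairing (fun t => f t - F0 t) w = c1 * pairing u1 w + c2 * pairing u2 w.
  apply: functional_combination; try exact: pairing_linear.
    exact: test_function_closed.
  move=> w tw w1 w2.
  have [u [p [c [d [ac db su sw up0]]]]] := compact_solution _ _ _ _ _ s1 s2 W tw w1 w2.
  (* A solution is unconstrained off [(a,b)]; the cut to [[c, d]] gives it support on the whole line
     and changes nothing inside. *)
  pose u' := u \_ `[c, d]%classic.
  have uu' t : oi a b t -> u t = u' t.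
    move=> abt; rewrite /u' patchE; case: ifPn => // /negP nt.
    by have [] := up0 t abt (fun h => nt (mem_set h)).
  have su' : solution u' p (fun t => w t * r t) by exact: solution_eq su.
  have spu' : supported c d u'.
    by move=> t nt; rewrite /u' patchE memNset.
  have := adj _ _ _ _ _ ac db tw su' spu' sw => adjE.
  have lw : locint mu a b (fun t => w t * r t).
    apply: locint_ext (test_locint (fun=> 1) w _ tw); first by move=> t _; rewrite mul1r.
    by apply: locint_ext lr => t _; rewrite mul1r.
  have [lL pL] := lagrange mu a b mufin s x sx0 _ _ _ _ _ _ cg (compatible_weight _ lw) sF su.
  have e : \int[mu]_(t in `[c, d]%classic) (F0 t * w t * r t) =
      \int[mu]_(t in `[c, d]%classic) (g t * u' t * r t).
    have [X Xc aX] := exists_between_left _ _ ac.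
    have [Y dY Yb] := exists_between_right _ _ db.
    (* If [Y <= X] then [[c, d]] is empty and both integrals are 0. *)
    have [XY|YX] := ltP X Y; last first.
      rewrite set_itv_ge ?Rintegral_set0//.
      by rewrite bnd_simp -ltNge (lt_le_trans dY)// (le_trans YX)// ltW.
    have sub : `[c, d]%classic `<=` `[X, Y[%classic.
      move=> y; rewrite /= !in_itv/= => /andP[cy yd].
      by rewrite (le_trans (ltW Xc) cy) (le_lt_trans yd).
    have := pL _ _ aX XY Yb.
    have abX : oi a b X by split => //; apply: lt_trans Yb; rewrite lte_fin.
    have abY : oi a b Y by split => //; apply: lt_trans aX _; rewrite lte_fin.
    have nX : ~ `[c, d]%classic X by rewrite /= in_itv/= leNgt Xc.
    have nY : ~ `[c, d]%classic Y by rewrite /= in_itv/= => /andP[_]; rewrite leNgt dY.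
    have [uX pX] := up0 X abX nX; have [uY pY] := up0 Y abY nY.
    rewrite uX pX uY pY !mulr0 !mul0r !subrr => /esym/eqP.
    rewrite RintegralB//; first last.
    - exact: (locint_ico _ _ _ _ _ _ (locint_mul _ _ _ mufin _ _ _ sF.1 lw)).
    - exact: (locint_ico _ _ _ _ _ _ (locint_mul _ _ _ mufin _ _ _ su.1 lg)).
    rewrite subr_eq0 => /eqP e.
    transitivity (\int[mu]_(t in `[X, Y[%classic) (F0 t * (w t * r t))).
      rewrite [RHS](Rint_support mu `[c, d]%classic)//.
        by apply: eq_Rint => t _; rewrite mulrA.
      by move=> t _ nt; rewrite sw// mul0r mulr0.
    rewrite -e [LHS](Rint_support mu `[c, d]%classic)//.
      apply: eq_Rint => t tcd; rewrite uu'; last exact: oi_itv tcd.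
      by ring.
    move=> t tXY nt; rewrite (up0 t _ nt).1 ?mul0r//.
    apply: (oi_itv a b X Y) => //.
    by move: t tXY {nt}; apply: subset_itvl; rewrite bnd_simp.
  rewrite (pairing_itv _ w c d `[c, d]%classic)//.
  rewrite (eq_Rint _ _ _ (fun t => f t * w t * r t - F0 t * w t * r t)); last first.
    by move=> t _; ring.
  rewrite RintegralB//; try exact: test_locint.
  by rewrite adjE e subrr.
pose F t := F0 t + (c1 * u1 t + c2 * u2 t).
pose q t := q0 t + (c1 * p1 t + c2 * p2 t).
exists F, q; split.
  have := solutionD mu a b s x _ _ _ _ _ _ sF (solutionD mu a b s x _ _ _ _ _ _
    (solutionZ mu a b s x c1 _ _ _ s1) (solutionZ mu a b s x c2 _ _ _ s2)).
  by apply: solution_eq => // t _; ring.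
move=> c d ac db.
have lfF' : locint mu a b (fun t => (f t - F t) * r t).
  apply: locint_ext (locintB _ _ _ _ _ lfF
    (locintD _ _ _ _ _ (locintZ _ _ _ c1 _ l1) (locintZ _ _ _ c2 _ l2))) => t _.
  by rewrite /F; ring.
apply: integral_ae_eq => //; first exact: lfF'.
move=> E Ecd mE; rewrite integral0.
have tE : test_function (\1_E).
  split; first exact: measurable_indic.
  - by exists 1 => t; rewrite indicE; case: (_ \in _); rewrite ?normr1 ?normr0.
  - exists c, d; split => // t nt; rewrite indicE memNset// => /Ecd; exact: nt.
have iE : intg mu E (fun t => (f t - F t) * r t).
  exact: (locint_subset mu a b _ c d E lfF' ac db mE Ecd).
suff : \int[mu]_(t in E) ((f t - F t) * r t) = 0.
  by rewrite /Rintegral => h0; rewrite -[LHS]fineK ?h0//; exact: integrable_fin_num.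
transitivity (pairing (fun t => f t - F0 t) \1_E -
    (c1 * pairing u1 \1_E + c2 * pairing u2 \1_E)); last by rewrite h// subrr.
rewrite /pairing -!RintegralZl//; try exact: test_integrable.
rewrite -RintegralD//; try (by apply: intgZ => //; exact: test_integrable).
rewrite -RintegralB//; first last.
- by apply: intgD => //; apply: intgZ => //; exact: test_integrable.
- exact: test_integrable.
rewrite Rintegral_mkcond; apply: eq_Rint => t _; rewrite patchE indicE /F.
case: (t \in E) => /=; first by ring.
by rewrite !(mulr0, mul0r) addr0 subr0.
Qed.

End MaximalOperator.

(** * Densities *)

Section Exhaustion.
Context {R : realType} (a b : \bar R).

(** Intervals with rational ends [p > a] and [q < b], enumerated by their codes; all other codes
    give the degenerate [[c0, c0]]. Finite and infinite [a], [b] need no distinction. *)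
Lemma oi_exhaustion : (exists c, oi a b c) -> exists c d : nat -> R,
  (forall n, (a < (c n)%:E)%E /\ ((d n)%:E < b)%E) /\
  oi a b = \bigcup_n `[c n, d n]%classic.
Proof.
move=> [c0 [ac0 c0b]].
pose good (pq : rat * rat) := ((a < (ratr pq.1 : R)%:E) && ((ratr pq.2 : R)%:E < b))%E.
pose e n : R * R := if unpickle n is Some pq then
  if good pq then (ratr pq.1, ratr pq.2) else (c0, c0) else (c0, c0).
have eP n : (a < (e n).1%:E)%E /\ ((e n).2%:E < b)%E.
  rewrite /e; case: unpickle => [pq|//].
  by case: ifPn => [/andP[]|].
exists (fun n => (e n).1), (fun n => (e n).2); split => //.
apply/seteqP; split => [x [ax xb]|x [n _]]; last first.
  by apply: oi_itv; have [] := eP n.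
have [X Xx aX] := exists_between_left _ _ ax.
have [Y xY Yb] := exists_between_right _ _ xb.
have [p] := rat_in_itvoo Xx; rewrite in_itv/= => /andP[Xp px].
have [q] := rat_in_itvoo xY; rewrite in_itv/= => /andP[xq qY].
have g : good (p, q).
  apply/andP; split; first by apply: lt_trans aX _; rewrite lte_fin.
  by apply: lt_trans Yb; rewrite lte_fin.
exists (pickle (p, q)) => //.
have -> : e (pickle (p, q)) = (ratr p, ratr q) by rewrite /e pickleK g.
by rewrite /= in_itv/= !ltW.
Qed.

Lemma measurable_oi : measurable (oi a b).
Proof.
have [ne|e] := pselect (exists c, oi a b c); last first.
  rewrite (_ : oi a b = set0)//; apply/seteqP; split => // c abc.
  by apply: e; exists c.
by have [c [d [_ ->]]] := oi_exhaustion ne; exact: bigcup_measurable.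
Qed.

Lemma measurable_fun_oi (f : R -> R) : (forall c d : R, (a < c%:E)%E -> (d%:E < b)%E ->
  measurable_fun `[c, d]%classic f) -> measurable_fun (oi a b) f.
Proof.
move=> h; have [ne|e] := pselect (exists c, oi a b c); last first.
  rewrite (_ : oi a b = set0); first exact: measurable_fun_set0.
  by apply/seteqP; split => // c abc; apply: e; exists c.
have [c [d [cd ->]]] := oi_exhaustion ne.
by apply/measurable_fun_bigcup => // n; have [] := cd n; exact: h.
Qed.

Lemma negligible_oi (mu : {measure set R -> \bar R}) (N : set R) :
  (forall c d : R, (a < c%:E)%E -> (d%:E < b)%E -> mu.-negligible (`[c, d]%classic `&` N)) ->
  mu.-negligible (oi a b `&` N).
Proof.
move=> h; have [ne|e] := pselect (exists c, oi a b c); last first.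
  rewrite (_ : oi a b = set0) ?set0I; first exact: negligible_set0.
  by apply/seteqP; split => // c abc; apply: e; exists c.
have [c [d [cd ->]]] := oi_exhaustion ne.
rewrite setI_bigcupl; apply: negligible_bigcup => n.
by have [] := cd n; exact: h.
Qed.

Lemma locfin_sigma_finite (nu : {measure set R -> \bar R}) :
  (exists c, oi a b c) -> locfin a b nu -> sigma_finite setT nu.
Proof.
move=> ne [nu0 fin]; have [c [d [cd e]]] := oi_exhaustion ne.
(* Index 0 holds the complement of [(a,b)], where [nu] has no mass. *)
exists (fun n => if n is k.+1 then `[c k, d k]%classic else ~` oi a b).
  apply/seteqP; split => // t _.
  have [abt|nt] := pselect (oi a b t); last by exists 0%N.
  by move: abt; rewrite e => -[n _ tn]; exists n.+1.
case => [|n]; first by split; [apply: measurableC; exact: measurable_oi|rewrite nu0].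
by split => //; have [] := cd n; exact: fin.
Qed.

End Exhaustion.

Section SigmaFiniteCopy.
Context {R : realType} (nu : {measure set R -> \bar R}).

(** The proof is an argument of the copy so that a sigma-finite structure can be attached to it. *)
Definition locfin_copy (h : sigma_finite setT nu) : set R -> \bar R := nu.

HB.instance Definition _ h := Measure.copy (locfin_copy h) nu.
HB.instance Definition _ h := Measure_isSigmaFinite.Build _ _ _ (locfin_copy h) h.

End SigmaFiniteCopy.

Section DensityOf.
Context {R : realType}.
Implicit Types (A : set R) (h : R -> R).

Definition is_density (mu nu : {measure set R -> \bar R}) (s : R -> R) :=
  [/\ measurable_fun setT s, (forall x, 0 <= s x) &
    forall (A : set R) (f : R -> \bar R), measurable A -> measurable_fun A f ->
      (forall x, 0 <= f x)%E ->
      (\int[nu]_(x in A) f x = \int[mu]_(x in A) (f x * (s x)%:E))%E].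

Lemma locfin_density (a b : \bar R) (mu : {sigma_finite_measure set R -> \bar R})
  (nu : {measure set R -> \bar R}) : (exists c, oi a b c) -> locfin a b nu ->
  (forall A, measurable A -> (nu A <= mu A)%E) -> exists s, is_density mu nu s.
Proof.
move=> ne lf le.
pose nu' : {sigma_finite_measure set R -> \bar R} := locfin_copy nu (locfin_sigma_finite a b nu ne lf).
have dom : nu' `<< mu.
  move=> N N0 A mA AN; apply/eqP; rewrite eq_le measure_ge0 andbT.
  by have := le A mA; rewrite (N0 A mA AN).
by have [s sP] := density_exists mu nu' dom; exists s.
Qed.

Section Theory.
Variables (mu nu : {measure set R -> \bar R}) (s : R -> R).
Hypothesis ds : is_density mu nu s.

Let ms : measurable_fun setT s. Proof. by case: ds. Qed.
Let s0 t : 0 <= s t. Proof. by case: ds. Qed.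
Let sP (A : set R) (f : R -> \bar R) : measurable A -> measurable_fun A f ->
  (forall x, 0 <= f x)%E ->
  (\int[nu]_(x in A) f x = \int[mu]_(x in A) (f x * (s x)%:E))%E.
Proof. by case: ds => _ _; apply. Qed.

Lemma density_intg A h : measurable A -> measurable_fun A h ->
  intg nu A h <-> intg mu A (fun t => h t * s t).
Proof.
move=> mA mh.
have mhs : measurable_fun A (fun t => h t * s t).
  by apply: measurable_funM => //; exact: measurable_funTS.
have e : (\int[nu]_(x in A) `|(h x)%:E| = \int[mu]_(x in A) `|(h x * s x)%:E|)%E.
  rewrite sP//.
    by apply: eq_integral => t _; rewrite /= normrM (ger0_norm (s0 t)) EFinM.
  by apply: measurableT_comp => //; exact/measurable_EFinP.
split => /integrableP[_ i]; apply/integrableP; split; try exact/measurable_EFinP.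
  by rewrite -[ltLHS]/(\int[mu]_(x in A) `|(h x * s x)%:E|)%E -e.
by rewrite -[ltLHS]/(\int[nu]_(x in A) `|(h x)%:E|)%E e.
Qed.

(** As [s] is nonnegative, the positive and negative parts of [h s] are those of [h] times [s]. *)
Lemma density_Rint A h : measurable A -> intg nu A h ->
  \int[nu]_(t in A) h t = \int[mu]_(t in A) (h t * s t).
Proof.
move=> mA ih; have mh := intg_meas _ _ _ ih.
rewrite /Rintegral; congr fine; rewrite integralE [RHS]integralE.
have e (f g : R -> \bar R) : measurable_fun A f -> (forall t, 0 <= f t)%E ->
    (forall t, g t = f t * (s t)%:E)%E ->
    (\int[nu]_(t in A) f t = \int[mu]_(t in A) g t)%E.
  by move=> mf f0 gf; rewrite sP//; apply: eq_integral => t _; rewrite gf.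
congr (_ - _)%E; apply: e => //.
- by apply: measurable_funepos; exact/measurable_EFinP.
- move=> t; rewrite !funeposE/= -!EFin_max -EFinM.
  by rewrite maxr_pMl// mul0r.
- by apply: measurable_funeneg; exact/measurable_EFinP.
- move=> t; rewrite !funenegE/= -!EFin_max -EFinM.
  by rewrite maxr_pMl// mul0r mulNr.
Qed.

Lemma density_measure A : measurable A -> (nu A < +oo)%E ->
  intg mu A s /\ fine (nu A) = \int[mu]_(t in A) s t.
Proof.
move=> mA fin.
have i1 : intg nu A (fun=> 1) by apply: (intg_bounded _ _ 1) => // t _; rewrite normr1.
have i : intg mu A s.
  by apply: (eq_intg _ _ (fun t => 1 * s t)) => //; [move=> t _; rewrite mul1r|
    apply/(density_intg A (fun=> 1))].
split => //; have := density_Rint A _ mA i1.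
rewrite Rintegral_cst// mul1r => ->.
by apply: eq_Rint => t _; rewrite mul1r.
Qed.

Lemma density_negligible A : measurable A -> (nu A < +oo)%E ->
  (forall B, measurable B -> B `<=` A -> \int[mu]_(t in B) s t = 0) -> nu A = 0%E.
Proof.
move=> mA fin h; have [_ e] := density_measure A mA fin.
by rewrite -[LHS]fineK ?ge0_fin_numE// e h.
Qed.

End Theory.
End DensityOf.

(** * Almost-everywhere uniqueness of densities and left continuity *)

Section PrimitiveAe.
Context {R : realType} (mu : {sigma_finite_measure set R -> \bar R}) (a b : \bar R).

(** The sets over which [w] integrates to 0 form a Dynkin system, and the rays [[y, +oo)] are stable
    under intersection and generate the Borel sets. The integral over all of [A] is what complements
    require. *)
Lemma null_integral_ae (w : R -> R) (A : set R) : measurable A -> intg mu A w ->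
  (forall y, \int[mu]_(t in A `&` `[y, +oo[%classic) w t = 0) ->
  \int[mu]_(t in A) w t = 0 ->
  ae_eq mu A (EFin \o w) (cst 0%E).
Proof.
move=> mA iw h0 hA; apply: integral_ae_eq => // E EA mE; rewrite integral0.
pose P (S : set R) := (\int[mu]_(t in A `&` S) (w t)%:E = 0)%E.
have iS S : measurable S -> intg mu (A `&` S) w.
  by move=> mS; apply: integrableS iw => //; exact: measurableI.
have toE S : measurable S -> \int[mu]_(t in A `&` S) w t = 0 -> P S.
  move=> mS; rewrite /P /Rintegral => z; rewrite -[LHS]fineK ?z//.
  by apply: integrable_fin_num => //; [exact: measurableI|exact: iS].
suff : P E by rewrite /P (setIidr EA).
have mEq : @measurable _ R = <<s @RGenCInfty.G R >> by exact: RGenCInfty.measurableE.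
apply: (dynkin_induction mEq) => //.
- move=> _ _ [y1 ->] [y2 ->]; exists (Num.max y1 y2).
  by apply/seteqP; split => t /=; rewrite !in_itv/= !andbT ge_max;
    [move=> [-> ->]|move=> /andP[]].
- by apply: toE => //; rewrite setIT.
- by move=> _ [y ->]; exact: toE.
- move=> S mS PS; apply: toE; first exact: measurableC.
  have := Rint_sub mu (A `&` S) (A `&` ~` S) A w; rewrite hA.
  rewrite {1}/Rintegral PS/= add0r => <- //.
  + exact: measurableI.
  + by apply: measurableI => //; exact: measurableC.
  + by rewrite setIACA setICr setI0.
  + by rewrite -setIUr setUCr setIT.
- move=> F mF tF PF; rewrite /P setI_bigcupr integral_bigcup.
  + by apply: eseries0 => n _ _; exact: PF.
  + exact: trivIset_setIl.
  + by move=> n; exact: measurableI.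
  + by rewrite -setI_bigcupr; apply: iS; exact: bigcup_measurable.
- by rewrite -mEq.
Qed.

Lemma primitive0_ae G w : primitive mu a b G w -> (forall t, oi a b t -> G t = 0) ->
  forall c d : R, (a < c%:E)%E -> (d%:E < b)%E ->
  ae_eq mu `[c, d]%classic (EFin \o w) (cst 0%E).
Proof.
move=> [lw pG] G0 c d ac db; have [X dX Xb] := exists_between_right _ _ db.
have zero (y : R) : \int[mu]_(t in `[Num.max c y, X[%classic) w t = 0.
  have [yX|Xy] := ltP (Num.max c y) X; last first.
    by rewrite set_itv_ge ?bnd_simp -?leNgt// Rintegral_set0.
  have am : (a < (Num.max c y)%:E)%E.
    by apply: lt_le_trans ac _; rewrite lee_fin le_max lexx.
  rewrite -pG// !G0 ?subrr//; split => //.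
    by apply: lt_trans Xb; rewrite lte_fin.
  by apply: lt_trans am _; rewrite lte_fin.
apply: (@ae_eq_subset _ _ _ _ mu `[c, X[%classic).
  by apply: subset_itvl; rewrite bnd_simp.
apply: null_integral_ae => //; first exact: (locint_ico mu a b w c X lw).
  move=> y; rewrite (_ : _ `&` _ = `[Num.max c y, X[%classic)//.
  apply/seteqP; split => t /=; rewrite !in_itv/= !andbT ge_max.
    by move=> [/andP[-> ->] ->].
  by move=> /andP[/andP[-> ->] ->].
by have := zero c; rewrite maxxx.
Qed.

(** The interval [[t, t0)] shrinks to the empty set as [t] increases to [t0], since the atom at [t0]
    is left out; dominated convergence does the rest. *)
Lemma primitive_left_continuous G w (t0 e : R) : primitive mu a b G w -> oi a b t0 -> 0 < e ->
  exists X : R, [/\ X < t0, (a < X%:E)%E &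
    forall t, X <= t -> t < t0 -> `|G t0 - G t| < e].
Proof.
move=> [lw pG] [at0 t0b] e0.
have [X0 X0t aX0] := exists_between_left _ _ at0.
have iw : intg mu `[X0, t0[%classic w by exact: (locint_ico mu a b w X0 t0 lw).
(* These points increase to [t0], so [v n], which is [|w|] cut off before [Y n], is eventually 0 at
   each point. *)
pose Y n := Num.max X0 (t0 - n.+1%:R^-1).
have Yt n : Y n < t0 by rewrite gt_max X0t/= ltrBlDr ltrDl invr_gt0 ltr0n.
have aY n : (a < (Y n)%:E)%E by apply: lt_le_trans aX0 _; rewrite lee_fin le_max lexx.
pose v n t := if t < Y n then 0 else `|w t|.
have inw : intg mu `[X0, t0[%classic (fun t => `|w t|) by exact: integrable_norm.
have mv n : measurable_fun `[X0, t0[%classic (v n).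
  apply: (eq_measurable_fun (fun t => \1_(`[Y n, +oo[%classic) t * `|w t|)).
    move=> t _; rewrite /v indicE; have [tY|Yt'] := ltP t (Y n).
      by rewrite memNset ?mul0r//= in_itv/= andbT leNgt tY.
    by rewrite mem_set ?mul1r//= in_itv/= andbT.
  apply: measurable_funM; last exact: (intg_meas mu).
  by apply: measurable_funTS; exact: measurable_indic.
have cv : (\int[mu]_(t in `[X0, t0[%classic) (v n t)%:E)%E @[n --> \oo] -->
    (\int[mu]_(t in `[X0, t0[%classic) (cst 0%E t))%E.
  apply: (@dominated_cvg _ _ _ mu `[X0, t0[%classic _ (fun n t => (v n t)%:E) _
    (fun t => `|w t|%:E)) => //.
  - by move=> n; exact/measurable_EFinP.
  - move=> t; rewrite /= in_itv/= => /andP[_ tt0].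
    apply: cvg_near_cst; near=> n.
    rewrite /v ifT// lt_max; apply/orP; right.
    rewrite ltrBrDr -ltrBrDl -[ltRHS]invrK ltf_pV2 ?posrE ?invr_gt0 ?subr_gt0//.
    apply: lt_trans (_ : n%:R < _); last by rewrite ltr_nat.
    near: n; exact: nbhs_infty_gtr.
  - move=> n t _; rewrite lee_fin /v; case: ifP => _; first by rewrite normr0.
    by rewrite normr_id.
rewrite integral0 in cv.
have rcv : \int[mu]_(t in `[X0, t0[%classic) v n t @[n --> \oo] --> 0 by exact: fine_cvg cv.
have [N _ /(_ N (leqnn N)) /= small] := cvgr0_norm_lt _ rcv e e0.
exists (Y N); split => // t Yt' tt0.
have at_ : (a < t%:E)%E by apply: lt_le_trans (aY N) _; rewrite lee_fin.
rewrite pG//; apply: le_lt_trans (le_normr_Rintegral _ _) _ => //.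
  exact: (locint_ico mu a b w t t0 lw).
have iv : intg mu `[X0, t0[%classic (v N).
  apply: (le_intg _ _ _ (fun t => `|w t|)) => // u _.
  by rewrite /v; case: ifP => _; rewrite ?normr0 ?normr_id.
have X0t' : X0 <= t by apply: le_trans Yt'; rewrite le_max lexx.
rewrite (eq_Rint _ _ _ (fun u => `|v N u|)); last first.
  move=> u; rewrite /= in_itv/= => /andP[tu _].
  by rewrite /v ltNge (le_trans Yt' tu)/= normr_id.
apply: le_lt_trans (Rint_subset mu _ `[X0, t0[%classic _ _ _ _ iv) _ => //.
  by move=> u; rewrite /= !in_itv/= => /andP[/(le_trans X0t') -> ->].
apply: le_lt_trans small; rewrite (eq_Rint _ _ _ (v N)) ?ler_norm//.
by move=> u _; rewrite ger0_norm// /v; case: ifP.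
Unshelve. all: by end_near. Qed.

End PrimitiveAe.

(** * Consequences of the full support of sigma *)

Section Vanishing.
Context {R : realType} (mu : {sigma_finite_measure set R -> \bar R}).

Lemma primitive_sub (a b l m : \bar R) G w : (a <= l)%E -> (m <= b)%E ->
  primitive mu a b G w -> primitive mu l m G w.
Proof.
move=> al mb [lw pG]; split.
  by move=> c d lc dm; apply: lw; [exact: le_lt_trans lc|exact: lt_le_trans mb].
by move=> c d lc cd dm; apply: pG => //; [exact: le_lt_trans lc|exact: lt_le_trans mb].
Qed.

(** From [u = 0] one gets [p s = 0] almost everywhere. If [p t0] were nonzero, left continuity would
    keep [p] nonzero just before [t0], so [s] would vanish on an interval of positive length. *)
Lemma quasi_derivative_zero (l m : \bar R) (u p v s : R -> R) :
  measurable_fun setT s ->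
  primitive mu l m u (fun t => p t * s t) -> primitive mu l m p v ->
  (forall t, oi l m t -> u t = 0) ->
  (forall c d : R, (l < c%:E)%E -> c < d -> (d%:E < m)%E ->
    ~ (forall B, measurable B -> B `<=` `[c, d]%classic -> \int[mu]_(t in B) s t = 0)) ->
  forall t, oi l m t -> p t = 0.
Proof.
move=> ms pu pp u0 supp t0 lmt0; apply/eqP; apply/negP => /negP pt0.
have e0 : 0 < `|p t0| by rewrite normr_gt0.
have [X [Xt0 lX near]] := primitive_left_continuous mu l m p v t0 _ pp lmt0 e0.
(* The midpoint keeps the closed interval [[X, d]] inside the range where [p] is known to be
   nonzero. *)
have [lt0 t0m] := lmt0; pose d := (X + t0) / 2.
have Xd : X < d by rewrite /d; lra.
have dt0 : d < t0 by rewrite /d; lra.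
have dm : (d%:E < m)%E by apply: lt_trans t0m; rewrite lte_fin.
apply: (supp X d lX Xd dm) => B mB BXd.
rewrite /Rintegral (ae_eq_integral (cst 0%E)) ?integral0//.
  by apply/measurable_EFinP; exact: measurable_funTS.
apply: filterS (primitive0_ae mu l m _ _ pu u0 X d lX dm) => t h Bt /=.
have := BXd t Bt; rewrite /= in_itv/= => /andP[Xt td].
have [/eqP] := h (BXd t Bt); rewrite mulf_eq0 => /orP[/eqP pt|/eqP -> //].
by have := near t Xt (le_lt_trans td dt0); rewrite pt subr0 ltxx.
Qed.

End Vanishing.

Section SupportDensity.
Context {R : realType} (mu : {sigma_finite_measure set R -> \bar R}) (a b : \bar R).

(** Vanishing integrals mean [mp = mn] on [[c, d]]. As the two are mutually singular, both are null
    there, which contradicts the support condition at the midpoint. *)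
Lemma support_density (mp mn : {measure set R -> \bar R}) (m1 m2 : R -> R) :
  is_density mu mp m1 -> is_density mu mn m2 -> locfin_signed a b mp mn ->
  (forall x, oi a b x -> supp a b (fun A => mp A + mn A)%E x) ->
  forall c d : R, (a < c%:E)%E -> c < d -> (d%:E < b)%E ->
  ~ (forall B, measurable B -> B `<=` `[c, d]%classic ->
       \int[mu]_(t in B) (m1 t - m2 t) = 0).
Proof.
move=> d1 d2 [[_ f1] [[_ f2] [S [mS [pS nS]]]]] sup c d ac cd db h.
have fin (m : {measure set R -> \bar R}) B : (m `[c, d]%classic < +oo)%E -> measurable B ->
    B `<=` `[c, d]%classic -> (m B < +oo)%E.
  by move=> fm mB Bcd; apply: le_lt_trans fm; apply: le_measure; rewrite ?inE.
have eqm B : measurable B -> B `<=` `[c, d]%classic -> mp B = mn B.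
  move=> mB Bcd; have g1 := fin mp B (f1 c d ac db) mB Bcd.
  have g2 := fin mn B (f2 c d ac db) mB Bcd.
  have [i1 e1] := density_measure mu mp m1 d1 B mB g1.
  have [i2 e2] := density_measure mu mn m2 d2 B mB g2.
  rewrite -[LHS]fineK ?ge0_fin_numE// -[RHS]fineK ?ge0_fin_numE//.
  by congr EFin; apply/eqP; rewrite -subr_eq0 e1 e2 -RintegralB// h.
pose I := `[c, d]%classic : set R.
have mI : measurable I by exact: measurable_itv.
have mIS : measurable (I `&` S) by exact: measurableI.
have mIC : measurable (I `&` ~` S) by apply: measurableI => //; exact: measurableC.
have null (m : {measure set R -> \bar R}) A B : measurable A -> measurable B -> A `<=` B ->
    m B = 0%E -> m A = 0%E.
  by move=> mA mB AB B0; apply: subset_measure0 AB B0.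
have nIS : mn (I `&` S) = 0%E by apply: (null mn _ S).
have pIC : mp (I `&` ~` S) = 0%E by apply: (null mp _ (~` S)) => //; exact: measurableC.
have IE : I = (I `&` S) `|` (I `&` ~` S) by rewrite -setIUr setUCr setIT.
have dis : (I `&` S) `&` (I `&` ~` S) = set0 by rewrite setIACA setICr setI0.
have II : I `&` S `<=` I by move=> t [].
have p0 : mp I = 0%E.
  have := measureU mp mIS mIC dis; rewrite -IE => ->.
  rewrite -[RHS]adde0; congr (_ + _)%E; last exact: pIC.
  exact: etrans (eqm _ mIS II) nIS.
have n0 : mn I = 0%E by rewrite -(eqm I mI).
have abm : oi a b ((c + d) / 2).
  by apply: (oi_itv a b c d) => //; rewrite /= in_itv/=; apply/andP; split; lra.
pose J : set R := `](c + d) / 2 - (d - c) / 2, (c + d) / 2 + (d - c) / 2[%classic.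
have mJ : measurable J by exact: measurable_itv.
have JI : J `<=` I.
  move=> y; rewrite /J /I /= !in_itv/= => /andP[h1 h2]; apply/andP; split; lra.
have [_ /(_ ((d - c) / 2))] := sup _ abm.
have -> : [set y : R | ((c + d) / 2 - (d - c) / 2 < y < (c + d) / 2 + (d - c) / 2)%R] = J.
  by apply/seteqP; split => y; rewrite /J /= in_itv.
have -> : mp J = 0%E := null mp J I mJ mI JI p0.
have -> : mn J = 0%E := null mn J I mJ mI JI n0.
move=> pos; have : (0 < (0%:E + 0%:E) :> \bar R)%E by apply: pos; lra.
by rewrite adde0 ltxx.
Qed.

End SupportDensity.

(** * Complex functions through their real and imaginary parts *)

Section ComplexParts.
Context {R : realType}.
Local Notation C := (complex.complex R).

(** A Boolean index, [true] for the real part, lets one statement cover both parts, which real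
    coefficients do not mix. *)
Definition part (e : bool) (z : C) : R := if e then complex.Re z else complex.Im z.

Lemma part_eq (y z : C) : (forall e, part e y = part e z) -> y = z.
Proof. by case: y z => [y1 y2] [z1 z2] h; congr complex.Complex; [exact: (h true)|exact: (h false)]. Qed.

Lemma partD e (y z : C) : part e (y + z) = part e y + part e z.
Proof. by case: e; case: y; case: z. Qed.

Lemma partN e (z : C) : part e (- z) = - part e z.
Proof. by case: e; case: z. Qed.

Lemma partB e (y z : C) : part e (y - z) = part e y - part e z.
Proof. by rewrite partD partN. Qed.

Lemma part0 e : part e (0 : C) = 0. Proof. by case: e. Qed.

Lemma part_cint (m : {measure set R -> \bar R}) (A : set R) (h : R -> C) e :
  part e (cint m A h) = \int[m]_(t in A) part e (h t).
Proof. by case: e. Qed.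

Lemma part_sint (mp mn : {measure set R -> \bar R}) (A : set R) (h : R -> C) e :
  part e (sint mp mn A h) =
  \int[mp]_(t in A) part e (h t) - \int[mn]_(t in A) part e (h t).
Proof. by rewrite partB !part_cint. Qed.

Lemma cintegrableP (m : {measure set R -> \bar R}) (A : set R) (h : R -> C) :
  cintegrable m A h <-> forall e, intg m A (fun t => part e (h t)).
Proof. by split => [[i1 i2] []//|i]; split; [exact: (i true)|exact: (i false)]. Qed.

End ComplexParts.

Section OrientedIntegral.
Context {R : realType} (mu : {sigma_finite_measure set R -> \bar R}) (a b : \bar R).
Implicit Types (w : R -> R).

(** The convention of [iint] for real functions and the reference measure; it is the bridge from
    [isderiv] and [isderivP] to [primitive]. *)
Definition oint (c x : R) w : R :=
  if c < x then \int[mu]_(t in `[c, x[%classic) w t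
  else if x < c then - \int[mu]_(t in `[x, c[%classic) w t else 0.

Lemma primitive_oint G w c x : primitive mu a b G w -> oi a b c -> oi a b x ->
  G x = G c + oint c x w.
Proof.
move=> [_ pG] [ac cb] [ax xb]; rewrite /oint.
case: (ltgtP c x) => [cx|xc|->]; last by rewrite addr0.
  by rewrite -pG//; ring.
by rewrite -pG//; ring.
Qed.

Lemma oint_primitive G w c : oi a b c -> locint mu a b w ->
  (forall x, oi a b x -> G x = G c + oint c x w) -> primitive mu a b G w.
Proof.
move=> abc lw h; have [ac cb] := abc.
apply: (primitive_from_base mu a b G w c) => //.
  move=> x cx xb; rewrite h /oint ?cx//; split => //.
  by apply: lt_trans ac _; rewrite lte_fin.
move=> x xc ax; rewrite h /oint ?xc ?(ltNge c x) ?(ltW xc)//; split => //.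
by apply: lt_trans cb; rewrite lte_fin.
Qed.

Lemma oint_self c w : oint c c w = 0.
Proof. by rewrite /oint ltxx. Qed.

Lemma primitive_oint_self w c : oi a b c -> locint mu a b w ->
  primitive mu a b (fun x => oint c x w) w.
Proof.
by move=> abc lw; apply: (oint_primitive _ _ c) => // x _; rewrite oint_self add0r.
Qed.

End OrientedIntegral.

Section SignedDensity.
Context {R : realType} (mu : {sigma_finite_measure set R -> \bar R}) (a b : \bar R).
Variables (mp mn : {measure set R -> \bar R}) (m1 m2 : R -> R).
Hypothesis d1 : is_density mu mp m1.
Hypothesis d2 : is_density mu mn m2.
Hypothesis lf1 : locfin a b mp.
Hypothesis lf2 : locfin a b mn.
Let m t := m1 t - m2 t.

Lemma signed_density_measurable : measurable_fun setT m.
Proof. by apply: measurable_funB; [case: d1|case: d2]. Qed.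

Lemma signed_density_Rint (A : set R) (h : R -> R) : measurable A ->
  intg mp A h -> intg mn A h ->
  intg mu A (fun t => h t * m t) /\
  \int[mp]_(t in A) h t - \int[mn]_(t in A) h t = \int[mu]_(t in A) (h t * m t).
Proof.
move=> mA i1 i2; have mh := intg_meas _ _ _ i1.
have j1 := (density_intg mu mp m1 d1 A h mA mh).1 i1.
have j2 := (density_intg mu mn m2 d2 A h mA mh).1 i2.
split.
  by apply: (eq_intg _ _ (fun t => h t * m1 t - h t * m2 t)) => //;
    [move=> t _; rewrite -mulrBr|exact: intgB].
rewrite (density_Rint mu mp m1 d1)// (density_Rint mu mn m2 d2)// -RintegralB//.
by apply: eq_Rint => t _; rewrite -mulrBr.
Qed.

Lemma signed_density_locint : locint mu a b m.
Proof.
move=> c d ac db.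
have i (nu : {measure set R -> \bar R}) : locfin a b nu -> intg nu `[c, d]%classic (fun=> 1).
  move=> [_ f]; apply: (intg_bounded _ _ 1) => //; first exact: f.
  by move=> t _; rewrite normr1.
have [j _] := signed_density_Rint `[c, d]%classic (fun=> 1) (measurable_itv _) (i _ lf1) (i _ lf2).
by apply: eq_intg j => // t _; rewrite mul1r.
Qed.

Lemma signed_density_atom (t : R) : oi a b t -> (mu [set t] < +oo)%E ->
  smass mp mn t = m t * atom mu t.
Proof.
move=> [at_ tb] fin; rewrite /smass.
have f1 : (mp [set t] < +oo)%E by rewrite -set_itv1; exact: lf1.2.
have f2 : (mn [set t] < +oo)%E by rewrite -set_itv1; exact: lf2.2.
have [_ ->] := density_measure mu mp m1 d1 [set t] (measurable_set1 t) f1.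
have [_ ->] := density_measure mu mn m2 d2 [set t] (measurable_set1 t) f2.
by rewrite !Rint_set1// mulrBl.
Qed.

Lemma L1loc_part (h : R -> complex.complex R) (e : bool) (c d : R) :
  L1loc a b mp mn h -> (a < c%:E)%E -> (d%:E < b)%E ->
  intg mp `[c, d[%classic (fun t => part e (h t)) /\
  intg mn `[c, d[%classic (fun t => part e (h t)).
Proof.
move=> L ac db; have [/cintegrableP i1 /cintegrableP i2] := L c d ac db.
have sub : `[c, d[%classic `<=` `[c, d]%classic by apply: subset_itvl; rewrite bnd_simp.
by split; [apply: integrableS (i1 e)|apply: integrableS (i2 e)].
Qed.

Lemma L1loc_locint (h : R -> complex.complex R) e : L1loc a b mp mn h ->
  locint mu a b (fun t => part e (h t) * m t).
Proof.
move=> L c d ac db; have [/cintegrableP i1 /cintegrableP i2] := L c d ac db.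
by have [] := signed_density_Rint `[c, d]%classic _ (measurable_itv _) (i1 e) (i2 e).
Qed.

Lemma part_iint_sint (h : R -> complex.complex R) e c x : L1loc a b mp mn h ->
  oi a b c -> oi a b x ->
  part e (iint (sint mp mn) c x h) = oint mu c x (fun t => part e (h t) * m t).
Proof.
move=> L [ac cb] [ax xb]; rewrite /iint /oint.
have eI (al be : R) : (a < al%:E)%E -> (be%:E < b)%E ->
    part e (sint mp mn `[al, be[%classic h) =
    \int[mu]_(t in `[al, be[%classic) (part e (h t) * m t).
  move=> aal beb; have [i1 i2] := L1loc_part h e al be L aal beb.
  rewrite part_sint.
  by have [_ ->] := signed_density_Rint `[al, be[%classic _ (measurable_itv _) i1 i2.
by case: ifP => _; [exact: eI|case: ifP => _; [rewrite partN eI|rewrite part0]].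
Qed.

Lemma isderiv_primitive (f h : R -> complex.complex R) : isderiv a b mp mn f h ->
  forall e, primitive mu a b (fun t => part e (f t)) (fun t => part e (h t) * m t).
Proof.
move=> [L [c [abc hf]]] e; apply: (oint_primitive mu a b _ _ c) => //.
  exact: L1loc_locint.
by move=> x abx; rewrite hf// partD part_iint_sint.
Qed.

Lemma primitive_isderiv (f h : R -> complex.complex R) : (exists c, oi a b c) ->
  L1loc a b mp mn h ->
  (forall e, primitive mu a b (fun t => part e (f t)) (fun t => part e (h t) * m t)) ->
  isderiv a b mp mn f h.
Proof.
move=> [c abc] L pf; split => //; exists c; split => // x abx.
apply: part_eq => e; rewrite partD part_iint_sint//.
exact: (primitive_oint mu a b _ _ c x (pf e)).
Qed.

Hypothesis mufin : forall c d : R, (a < c%:E)%E -> (d%:E < b)%E ->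
  (mu `[c, d]%classic < +oo)%E.

(** Primitives are bounded and measurable on compact intervals, hence integrable for locally finite
    measures other than the one they come from. *)
Lemma primitive_L1loc (f : R -> complex.complex R) (w : bool -> R -> R) :
  (forall e, primitive mu a b (fun t => part e (f t)) (w e)) -> L1loc a b mp mn f.
Proof.
move=> pf c d ac db; split; apply/cintegrableP => e;
  have mf := primitive_measurable mu a b mufin _ _ c d (pf e) ac db;
  have [C fC] := primitive_bounded mu a b _ _ c d (pf e) ac db;
  apply: intg_bounded fC => //.
- exact: lf1.2.
- exact: lf2.2.
Qed.

End SignedDensity.

Section WeightDensity.
Context {R : realType} (mu : {sigma_finite_measure set R -> \bar R}) (a b : \bar R).
Variables (rho : {measure set R -> \bar R}) (r : R -> R).
Hypothesis dr : is_density mu rho r.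
Hypothesis lfr : locfin a b rho.

Lemma L1locP_locint (k : R -> complex.complex R) e : L1locP a b rho k ->
  locint mu a b (fun t => part e (k t) * r t).
Proof.
move=> L c d ac db; have /cintegrableP i := L c d ac db.
by apply/(density_intg mu rho r dr) => //; exact: (intg_meas _ _ _ (i e)).
Qed.

Lemma part_iint_cint (k : R -> complex.complex R) e c x : L1locP a b rho k ->
  oi a b c -> oi a b x ->
  part e (iint (cint rho) c x k) = oint mu c x (fun t => part e (k t) * r t).
Proof.
move=> L [ac cb] [ax xb]; rewrite /iint /oint.
have eI (al be : R) : (a < al%:E)%E -> (be%:E < b)%E ->
    part e (cint rho `[al, be[%classic k) =
    \int[mu]_(t in `[al, be[%classic) (part e (k t) * r t).
  move=> aal beb; have /cintegrableP i := L al be aal beb.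
  rewrite part_cint (density_Rint mu rho r dr)//.
  by apply: integrableS (i e) => //; apply: subset_itvl; rewrite bnd_simp.
by case: ifP => _; [exact: eI|case: ifP => _; [rewrite partN eI|rewrite part0]].
Qed.

Lemma isderivP_primitive (F k : R -> complex.complex R) : isderivP a b rho F k ->
  forall e, primitive mu a b (fun t => part e (F t)) (fun t => part e (k t) * r t).
Proof.
move=> [L [c [abc hF]]] e; apply: (oint_primitive mu a b _ _ c) => //.
  exact: L1locP_locint.
by move=> x abx; rewrite hF// partD part_iint_cint.
Qed.

Lemma primitive_isderivP (F k : R -> complex.complex R) : (exists c, oi a b c) ->
  L1locP a b rho k ->
  (forall e, primitive mu a b (fun t => part e (F t)) (fun t => part e (k t) * r t)) ->
  isderivP a b rho F k.
Proof.
move=> [c abc] L pF; split => //; exists c; split => // x abx.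
apply: part_eq => e; rewrite partD part_iint_cint//.
exact: (primitive_oint mu a b _ _ c x (pF e)).
Qed.

Lemma weight_atom (t : R) : oi a b t -> (mu [set t] < +oo)%E ->
  fine (rho [set t]) = r t * atom mu t.
Proof.
move=> [at_ tb] fin.
have f1 : (rho [set t] < +oo)%E by rewrite -set_itv1; exact: lfr.2.
have [_ ->] := density_measure mu rho r dr [set t] (measurable_set1 t) f1.
by rewrite Rint_set1.
Qed.

Lemma weight_locint : locint mu a b r.
Proof.
move=> c d ac db.
by have [] := density_measure mu rho r dr `[c, d]%classic (measurable_itv _) (lfr.2 c d ac db).
Qed.

(** Where [f] and [g] differ, [r] vanishes almost everywhere for [mu], and [rho] does not charge
    such a set. *)
Lemma weight_ae (f g : R -> R) (A : set R) : measurable A -> (rho A < +oo)%E ->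
  measurable_fun A f -> measurable_fun A g ->
  ae_eq mu A (fun t => ((f t - g t) * r t)%:E) (cst 0%E) ->
  rho.-negligible (A `&` [set t | f t <> g t]).
Proof.
move=> mA fin mf mg ae; pose N := A `&` (fun t => f t - g t) @^-1` (~` [set 0]).
have mN : measurable N.
  have m : measurable_fun A (fun t => f t - g t) by exact: measurable_funB.
  by apply: m => //; apply: measurableC.
exists N; split => //.
  apply: (density_negligible mu rho r dr) => //.
    by apply: le_lt_trans fin; apply: le_measure; rewrite ?inE// => t [].
  move=> B mB BN; rewrite /Rintegral (ae_eq_integral (cst 0%E)) ?integral0//.
    by apply/measurable_EFinP; apply: measurable_funTS; case: dr.
  apply: filterS ae => t h Bt; have [At /= nz] := BN t Bt.
  have [/eqP] := h At; rewrite mulf_eq0 => /orP[/eqP //|/eqP -> //].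
by move=> t [At ne]; split => // /= /eqP; rewrite subr_eq0 => /eqP.
Qed.

End WeightDensity.

(** * Domain of the differential expression and first-order system *)

Section DtauSolutions.
Context {R : realType} (mu : {sigma_finite_measure set R -> \bar R}) (a b : \bar R).
Variables (rho sp sn xp xn : {measure set R -> \bar R}) (r s1 s2 x1 x2 : R -> R).
Hypothesis mufin : forall c d : R, (a < c%:E)%E -> (d%:E < b)%E ->
  (mu `[c, d]%classic < +oo)%E.
Hypothesis ab : exists c, oi a b c.
Hypothesis (dr : is_density mu rho r) (ds1 : is_density mu sp s1)
  (ds2 : is_density mu sn s2) (dx1 : is_density mu xp x1) (dx2 : is_density mu xn x2).
Hypothesis (lfr : locfin a b rho) (lfs1 : locfin a b sp) (lfs2 : locfin a b sn)
  (lfx1 : locfin a b xp) (lfx2 : locfin a b xn).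
Let s t := s1 t - s2 t.
Let x t := x1 t - x2 t.
Local Notation C := (complex.complex R).

(** The function [Q = \int f dchi - F] is a primitive, and it equals [h] almost everywhere for [sp]
    and [sn]. It may therefore replace [h] under the integrals against sigma. *)
Lemma Dtau_solution (f tf : R -> C) : Dtau a b rho sp sn xp xn f tf ->
  L1locP a b rho tf /\ exists q : bool -> R -> R, forall e,
    solution mu a b s x (fun t => part e (f t)) (q e) (fun t => part e (tf t) * r t).
Proof.
move=> [h [F [c [df [dF [abc [aep aen]]]]]]]; split; first exact: dF.1.
have ph := isderiv_primitive mu a b sp sn s1 s2 ds1 ds2 f h df.
have pF := isderivP_primitive mu a b rho r dr F tf dF.
have Lf := primitive_L1loc mu a b xp xn lfx1 lfx2 mufin f _ ph.
pose Q t := iint (sint xp xn) c t f - F t.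
have pQ e : primitive mu a b (fun t => part e (Q t))
    (fun t => part e (f t) * x t - part e (tf t) * r t).
  have lw := L1loc_locint mu a b xp xn x1 x2 dx1 dx2 f e Lf.
  have := primitiveB mu a b _ _ _ _ (primitive_oint_self mu a b _ c abc lw) (pF e).
  apply: primitive_eq => t abt.
  by rewrite partB (part_iint_sint mu a b xp xn x1 x2).
exists (fun e t => part e (Q t)) => e; split => //.
have LQ := primitive_L1loc mu a b sp sn lfs1 lfs2 mufin Q _ pQ.
split; first exact: (L1loc_locint mu a b sp sn s1 s2 ds1 ds2).
move=> al be aal albe beb; rewrite (ph e).2//.
have [i1 i2] := L1loc_part a b sp sn h e al be df.1 aal beb.
have [j1 j2] := L1loc_part a b sp sn Q e al be LQ aal beb.
have [_ <-] := signed_density_Rint mu sp sn s1 s2 ds1 ds2 `[al, be[%classic _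
  (measurable_itv _) i1 i2.
have [_ <-] := signed_density_Rint mu sp sn s1 s2 ds1 ds2 `[al, be[%classic _
  (measurable_itv _) j1 j2.
have eq_int (m : {measure set R -> \bar R}) :
    {ae m, forall t, oi a b t -> F t = - h t + iint (sint xp xn) c t f} ->
    intg m `[al, be[%classic (fun t => part e (h t)) ->
    intg m `[al, be[%classic (fun t => part e (Q t)) ->
    \int[m]_(t in `[al, be[%classic) part e (h t) =
    \int[m]_(t in `[al, be[%classic) part e (Q t).
  move=> ae ih iQ; rewrite /Rintegral; congr fine.
  apply: ae_eq_integral => //; [exact: measurable_int ih|exact: measurable_int iQ|].
  apply: filterS ae => t hF tI; congr EFin; congr part.
  rewrite /Q hF; first by rewrite opprD opprK addrCA subrr addr0.
  apply: (oi_itv a b al be) => //.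
  by move: t tI {hF}; apply: subset_itvl; rewrite bnd_simp.
by rewrite (eq_int sp) ?(eq_int sn).
Qed.

(** Reading the previous construction backwards, [F] is defined by the equation, which then holds at
    every point. *)
Lemma solution_Dtau (f tf : R -> C) (q : bool -> R -> R) : L1locP a b rho tf ->
  (forall e, solution mu a b s x (fun t => part e (f t)) (q e)
    (fun t => part e (tf t) * r t)) ->
  Dtau a b rho sp sn xp xn f tf.
Proof.
move=> Lt sol; have [c abc] := ab.
pose h t := complex.Complex (q true t) (q false t) : C.
have ph e t : part e (h t) = q e t by case: e.
have phE e : (fun t => part e (h t)) = q e by apply/funext => t.
have Lf := primitive_L1loc mu a b xp xn lfx1 lfx2 mufin f _ (fun e => (sol e).1).
have Lh : L1loc a b sp sn h.
  apply: (primitive_L1loc mu a b sp sn lfs1 lfs2 mufin h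
    (fun e t => part e (f t) * x t - part e (tf t) * r t)) => e.
  by rewrite phE; exact: (sol e).2.
pose F t := iint (sint xp xn) c t f - h t.
have Fh t : F t = - h t + iint (sint xp xn) c t f by rewrite addrC.
exists h, F, c; split.
  apply: (primitive_isderiv mu a b sp sn s1 s2) => // e.
  have [+ _] := sol e; apply: primitive_ext => t _.
  by rewrite ph.
split; last by split => //; split; apply: aeW => t _.
apply: (primitive_isderivP mu a b rho r) => // e.
have lw := L1loc_locint mu a b xp xn x1 x2 dx1 dx2 f e Lf.
have := primitiveB mu a b _ _ _ _ (primitive_oint_self mu a b _ c abc lw) (sol e).2.
move=> p; apply: (primitive_ext mu a b _ _ (fun t => part e (tf t) * r t)) (primitive_eq mu a b _ _ _ _ p).
  by move=> t _ /=; rewrite /x; ring.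
by move=> t abt; rewrite partB ph (part_iint_sint mu a b xp xn x1 x2).
Qed.

End DtauSolutions.

(** * Square-integrable functions and the inner product *)

Section SquareIntegrable.
Context {R : realType} (a b : \bar R) (rho : {measure set R -> \bar R}).
Local Notation C := (complex.complex R).

Lemma L2_measurable (u : R -> C) e : L2 a b rho u ->
  measurable_fun (oi a b) (fun t => part e (u t)).
Proof. by case: e => -[? []]. Qed.

Lemma L2_square (u : R -> C) : L2 a b rho u ->
  intg rho (oi a b) (fun t => part true (u t) ^+ 2 + part false (u t) ^+ 2).
Proof.
move=> Lu; have [m1 [m2 fin]] := Lu; apply/integrableP; split.
  by apply/measurable_EFinP; apply: measurable_funD; exact: measurable_funX.
apply: le_lt_trans fin; apply: ge0_le_integral => //.
- exact: measurable_oi.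
- apply: measurableT_comp => //; apply/measurable_EFinP.
  by apply: measurable_funD; exact: measurable_funX.
- by apply/measurable_EFinP; apply: measurable_funD; exact: measurable_funX.
- by move=> t _ /=; rewrite lee_fin ger0_norm// addr_ge0 ?sqr_ge0.
Qed.

Lemma part_square_le (z : C) e : part e z ^+ 2 <= part true z ^+ 2 + part false z ^+ 2.
Proof. by case: e; rewrite ?lerDl ?lerDr sqr_ge0. Qed.

(** Expanding [(|y| - |z|)^2 >= 0] bounds the product by the sum of squares. *)
Lemma L2_product (u v : R -> C) e e' : L2 a b rho u -> L2 a b rho v ->
  intg rho (oi a b) (fun t => part e (u t) * part e' (v t)).
Proof.
move=> Lu Lv; have mo : measurable (oi a b) by exact: measurable_oi.
apply: (le_intg _ _ _ (fun t => (part true (u t) ^+ 2 + part false (u t) ^+ 2) +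
  (part true (v t) ^+ 2 + part false (v t) ^+ 2))) => //.
- by apply: measurable_funM; exact: L2_measurable.
- move=> t _; rewrite normrM [leRHS]ger0_norm; last by rewrite !addr_ge0 ?sqr_ge0.
  have := part_square_le (u t) e; have := part_square_le (v t) e'.
  have := sqr_ge0 (`|part e (u t)| - `|part e' (v t)|).
  rewrite sqrrB !real_normK ?num_real//.
  have := sqr_ge0 (part e (u t)); have := sqr_ge0 (part e' (v t)).
  by rewrite -mulr_natr; lra.
- by apply: intgD => //; exact: L2_square.
Qed.

(** From [|y| <= 1 + y^2], since constants are integrable on compact intervals. *)
Lemma L2_L1locP (u : R -> C) : locfin a b rho -> L2 a b rho u -> L1locP a b rho u.
Proof.
move=> [_ fin] Lu c d ac db; apply/cintegrableP => e.
have sub : `[c, d]%classic `<=` oi a b by move=> t; exact: oi_itv.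
have mo : measurable (oi a b) by exact: measurable_oi.
apply: (le_intg _ _ _ (fun t => 1 + (part true (u t) ^+ 2 + part false (u t) ^+ 2))) => //.
- exact: measurable_funS sub (L2_measurable u e Lu).
- move=> t _; rewrite [leRHS]ger0_norm; last by rewrite !addr_ge0 ?sqr_ge0.
  have := part_square_le (u t) e; have := sqr_ge0 (`|part e (u t)| - 1).
  rewrite sqrrB1 real_normK ?num_real//.
  have := normr_ge0 (part e (u t)); rewrite -mulr_natr; lra.
- apply: intgD => //; last exact: integrableS sub (L2_square u Lu).
  by apply: (intg_bounded _ _ 1) => //; [exact: fin|move=> t _; rewrite normr1].
Qed.

(** The four real integrals that make up [ip]; Lagrange's identity applies to each of them. *)
Definition half_ip e e' (f g : R -> C) : R :=
  \int[rho]_(t in oi a b) (part e (f t) * part e' (g t)).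

Lemma part_ip (f g : R -> C) : L2 a b rho f -> L2 a b rho g ->
  part true (ip a b rho f g) = half_ip true true f g + half_ip false false f g /\
  part false (ip a b rho f g) = half_ip false true f g - half_ip true false f g.
Proof.
move=> Lf Lg; have mo : measurable (oi a b) by exact: measurable_oi.
have i e e' := L2_product f g e e' Lf Lg.
rewrite /ip !part_cint /half_ip -RintegralD// -RintegralB//; split;
  apply: eq_Rint => t _; case: (f t) => f1 f2; case: (g t) => g1 g2 /=; ring.
Qed.

End SquareIntegrable.

Section AlmostEverywhere.
Context {d} {T : measurableType d} {R : realType} (m : {measure set T -> \bar R}).

Lemma ae_intg (A : set T) (w h : T -> R) : measurable A -> measurable_fun A h ->
  {ae m, forall t, A t -> w t = h t} -> intg m A w ->
  intg m A h /\ \int[m]_(t in A) w t = \int[m]_(t in A) h t.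
Proof.
move=> mA mh ae iw; have mw := intg_meas _ _ _ iw.
split; last first.
  rewrite /Rintegral; congr fine; apply: ae_eq_integral => //.
  - by apply/measurable_EFinP.
  - by apply/measurable_EFinP.
  - by apply: filterS ae => t wh At; congr EFin; exact: wh.
apply/integrableP; split; first exact/measurable_EFinP.
move/integrableP : iw => [_]; congr (_ < _)%E; apply: ae_eq_integral => //.
- by apply: measurableT_comp => //; exact/measurable_EFinP.
- by apply: measurableT_comp => //; exact/measurable_EFinP.
- by apply: filterS ae => t wh At /=; rewrite wh.
Qed.

End AlmostEverywhere.

(** * Lagrange's identity against compactly supported solutions *)

Section CompactLagrange.
Context {R : realType} (mu : {sigma_finite_measure set R -> \bar R}) (a b : \bar R).
Hypothesis mufin : forall c d : R, (a < c%:E)%E -> (d%:E < b)%E ->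
  (mu `[c, d]%classic < +oo)%E.
Hypothesis ab : exists c, oi a b c.
Variables (s x r : R -> R).
Hypothesis ms : measurable_fun setT s.
Hypothesis sx0 : forall t, oi a b t -> s t * x t * atom mu t = 0.
Hypothesis sr0 : forall t, oi a b t -> s t * r t * atom mu t = 0.
Hypothesis full : forall c d : R, (a < c%:E)%E -> c < d -> (d%:E < b)%E ->
  ~ (forall B, measurable B -> B `<=` `[c, d]%classic -> \int[mu]_(t in B) s t = 0).

(** Once [f] and hence [q] vanish on [(l,m)], the equation [dq = - k dmu] leaves [k = 0] almost
    everywhere. *)
Let vanish (l m : \bar R) (f q k : R -> R) : (a <= l)%E -> (m <= b)%E ->
  solution mu a b s x f q k -> (forall t, oi l m t -> f t = 0) ->
  (forall t, oi l m t -> q t = 0) /\ mu.-negligible (oi l m `&` [set t | k t <> 0]).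
Proof.
move=> al mb [pf pq] f0.
have pf' := primitive_sub mu a b l m _ _ al mb pf.
have pq' := primitive_sub mu a b l m _ _ al mb pq.
have q0 : forall t, oi l m t -> q t = 0.
  apply: (quasi_derivative_zero mu l m f q _ s ms pf' pq' f0) => c d lc cd dm.
  by apply: full => //; [exact: le_lt_trans lc|exact: lt_le_trans mb].
split => //; apply: negligible_oi => c d lc dm.
apply: negligibleS (primitive0_ae mu l m _ _ pq' q0 c d lc dm) => t [tcd kt] /= h.
apply: kt; have [] := h tcd; rewrite f0; last exact: (oi_itv l m c d).
by rewrite mul0r sub0r => /eqP; rewrite oppr_eq0 => /eqP.
Qed.

(** Compact support is given for [f0] only. Applied to the two outer intervals, [vanish] removes the
    boundary terms and, almost everywhere, the tails of [g0 r]. *)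
Lemma compact_lagrange f q g f0 q0 g0 (c d : R) :
  locint mu a b (fun t => g t * r t) -> locint mu a b (fun t => g0 t * r t) ->
  solution mu a b s x f q (fun t => g t * r t) ->
  solution mu a b s x f0 q0 (fun t => g0 t * r t) ->
  (a < c%:E)%E -> (d%:E < b)%E ->
  (forall t, oi a b t -> t < c \/ d < t -> f0 t = 0) ->
  intg mu (oi a b) (fun t => f t * g0 t * r t) ->
  \int[mu]_(t in oi a b) (f t * g0 t * r t) = \int[mu]_(t in oi a b) (g t * f0 t * r t).
Proof.
move=> lg lg0 sf sf0 ac db supp0 ifg.
(* The extended [maxe] and [mine] include the cases [d <= a] and [c >= b], in which an outer
   interval is all of [(a,b)]. *)
have right : forall t, oi (maxe a d%:E) b t -> f0 t = 0.
  by move=> t [+ tb]; rewrite gt_max lte_fin => /andP[at_ dt]; apply: supp0 => //; right.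
have left : forall t, oi a (mine b c%:E) t -> f0 t = 0.
  by move=> t [at_]; rewrite lt_min lte_fin => /andP[tb tc]; apply: supp0 => //; left.
have al : (a <= maxe a d%:E)%E by rewrite le_max lexx.
have mb : (mine b c%:E <= b)%E by rewrite ge_min lexx.
have [qr nr] := vanish _ _ _ _ _ al (lexx b) sf0 right.
have [ql nl] := vanish _ _ _ _ _ (lexx a) mb sf0 left.
have [c0 [ac0 c0b]] := ab.
(* Keeping [c0] between [X] and [Y] ensures [X < Y] for every position of [c] and [d]. *)
have [X Xc aX] : exists2 X : R, X < Num.min c c0 & (a < X%:E)%E.
  by apply: exists_between_left; rewrite /Num.min; case: ifP.
have [Y dY Yb] : exists2 Y : R, Num.max d c0 < Y & (Y%:E < b)%E.
  by apply: exists_between_right; rewrite /Num.max; case: ifP.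
move: Xc dY; rewrite lt_min gt_max => /andP[Xc Xc0] /andP[dY c0Y].
have XY : X < Y by apply: lt_trans Xc0 c0Y.
have abX : oi a b X by split => //; apply: lt_trans c0b; rewrite lte_fin.
have abY : oi a b Y by split => //; apply: lt_trans ac0 _; rewrite lte_fin.
have oX : oi a (mine b c%:E) X by split => //; rewrite lt_min abX.2 lte_fin.
have oY : oi (maxe a d%:E) b Y by split => //; rewrite gt_max abY.1 lte_fin.
have cg := compatible_weight mu a b s r sr0 g lg.
have cg0 := compatible_weight mu a b s r sr0 g0 lg0.
have [lL pL] := lagrange mu a b mufin s x sx0 _ _ _ _ _ _ cg cg0 sf sf0.
have := pL X Y aX XY Yb; rewrite (left X oX) (ql X oX) (right Y oY) (qr Y oY).
rewrite !(mul0r, mulr0, subr0) => /esym/eqP.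
have sub : `[X, Y[%classic `<=` oi a b.
  move=> t tI; apply: (oi_itv a b X Y) => //.
  by move: t tI; apply: subset_itvl; rewrite bnd_simp.
have ioi : measurable (oi a b) by exact: measurable_oi.
have mI : measurable `[X, Y[%classic by exact: measurable_itv.
rewrite RintegralB//; first last.
- exact: (locint_ico mu a b _ X Y (locint_mul mu a b mufin _ _ _ sf.1 lg0) aX Yb).
- exact: (locint_ico mu a b _ X Y (locint_mul mu a b mufin _ _ _ sf0.1 lg) aX Yb).
rewrite subr_eq0 => /eqP e.
have outside t : oi a b t -> ~ `[X, Y[%classic t -> t < c \/ d < t.
  move=> _; rewrite /= in_itv/= => /negP; rewrite negb_and -ltNge -leNgt => /orP[tX|Yt].
    by left; exact: lt_trans Xc.
  by right; exact: lt_le_trans Yt.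
transitivity (\int[mu]_(t in `[X, Y[%classic) (f t * g0 t * r t)); last first.
  rewrite [RHS](Rint_support mu `[X, Y[%classic)//; last first.
    by move=> t abt nt; rewrite supp0 ?mulr0 ?mul0r//; exact: outside.
  transitivity (\int[mu]_(t in `[X, Y[%classic) (f t * (g0 t * r t))).
    by apply: eq_Rint => t _; rewrite mulrA.
  by rewrite -e; apply: eq_Rint => t _; ring.
rewrite (Rint_sub mu `[X, Y[%classic (oi a b `\` `[X, Y[%classic) (oi a b))//; first last.
- by rewrite setDUK.
- by rewrite setDIK.
- exact: measurableD.
(* The second integral runs over the tails, where [g0 r] is 0 almost everywhere. *)
rewrite [X in _ + X = _](_ : _ = 0) ?addr0// /Rintegral.
rewrite (ae_eq_integral (cst 0%E)) ?integral0//.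
- exact: measurableD.
- apply/measurable_EFinP; apply: measurable_funS (intg_meas _ _ _ ifg) => //.
- have := negligibleU nr nl; apply: negligibleS => t /= /not_implyP[[abt nt] ne].
  have g0r : g0 t * r t <> 0 by move=> z; apply: ne; rewrite -mulrA z mulr0.
  have [at_ tb] := abt.
  case: (outside t abt nt) => [tc|dt]; [right|left]; split => //; split => //.
    by rewrite lt_min tb lte_fin.
  by rewrite gt_max at_ lte_fin.
Qed.

End CompactLagrange.

(** * The two inclusions *)

Section Main.
Context {R : realType} (mu : {sigma_finite_measure set R -> \bar R}) (a b : \bar R).
Variables (rho sp sn xp xn : {measure set R -> \bar R}) (r s1 s2 x1 x2 : R -> R).
Hypothesis mufin : forall c d : R, (a < c%:E)%E -> (d%:E < b)%E ->
  (mu `[c, d]%classic < +oo)%E.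
Hypothesis ab : exists c, oi a b c.
Hypothesis (dr : is_density mu rho r) (ds1 : is_density mu sp s1)
  (ds2 : is_density mu sn s2) (dx1 : is_density mu xp x1) (dx2 : is_density mu xn x2).
Hypothesis (lfr : locfin a b rho) (lfs : locfin_signed a b sp sn)
  (lfx : locfin_signed a b xp xn).
Hypothesis full : forall x, oi a b x -> supp a b (fun A => sp A + sn A)%E x.
Hypothesis atoms : forall x, oi a b x -> smass sp sn x * smass xp xn x = 0 /\
  smass sp sn x * fine (rho [set x]) = 0.
Let s t := s1 t - s2 t.
Let x t := x1 t - x2 t.
Local Notation C := (complex.complex R).

Let fin1 t : oi a b t -> (mu [set t] < +oo)%E.
Proof. by move=> [at_ tb]; rewrite -set_itv1; exact: mufin. Qed.

(** (H4) speaks of point masses, that is densities times atoms; the system uses a product of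
    densities with a single atom. *)
Let mulatoms (y z m : R) : y * m * (z * m) = 0 -> y * z * m = 0.
Proof.
move=> /eqP; rewrite !mulf_eq0 => /orP[/orP[]|/orP[]] /eqP ->; by rewrite !(mul0r, mulr0).
Qed.

Let sx0 t : oi a b t -> s t * x t * atom mu t = 0.
Proof.
move=> abt; apply: mulatoms; have [+ _] := atoms t abt.
rewrite (signed_density_atom mu a b sp sn s1 s2 ds1 ds2 lfs.1 lfs.2.1)//; last exact: fin1.
by rewrite (signed_density_atom mu a b xp xn x1 x2 dx1 dx2 lfx.1 lfx.2.1)//; exact: fin1.
Qed.

Let sr0 t : oi a b t -> s t * r t * atom mu t = 0.
Proof.
move=> abt; apply: mulatoms; have [_] := atoms t abt.
rewrite (signed_density_atom mu a b sp sn s1 s2 ds1 ds2 lfs.1 lfs.2.1)//; last exact: fin1.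
by rewrite (weight_atom mu a b rho r dr lfr)//; exact: fin1.
Qed.

Let ls : locint mu a b s.
Proof. exact: (signed_density_locint mu a b sp sn s1 s2 ds1 ds2 lfs.1 lfs.2.1). Qed.

Let lx : locint mu a b x.
Proof. exact: (signed_density_locint mu a b xp xn x1 x2 dx1 dx2 lfx.1 lfx.2.1). Qed.

Let lr : locint mu a b r.
Proof. exact: (weight_locint mu a b rho r dr lfr). Qed.

Let mo : measurable (oi a b). Proof. exact: measurable_oi. Qed.

Let L1_measurable (tf : R -> C) e : L1locP a b rho tf ->
  measurable_fun (oi a b) (fun t => part e (tf t)).
Proof.
move=> L; apply: measurable_fun_oi => c d ac db.
by have /cintegrableP i := L c d ac db; exact: (intg_meas _ _ _ (i e)).
Qed.

Let primitive_oi (G w : R -> R) : primitive mu a b G w -> measurable_fun (oi a b) G.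
Proof.
by move=> pG; apply: measurable_fun_oi => c d; exact: (primitive_measurable mu a b mufin G w).
Qed.

Lemma Tmax_sub_adjoint u v : Tmax a b rho sp sn xp xn u v ->
  adjoint a b rho (T0 a b rho sp sn xp xn) u v.
Proof.
move=> [Lu [Lv [f [tf [D [uf vf]]]]]]; split => //; split => // u0 v0.
move=> [Lu0 [Lv0 [f0 [tf0 [D0 [[c [d [ac [db supp0]]]] [uf0 vf0]]]]]]].
have sol := Dtau_solution mu a b rho sp sn xp xn r s1 s2 x1 x2 mufin dr ds1 ds2 dx1 dx2
  lfs.1 lfs.2.1 lfx.1 lfx.2.1.
have [Ltf [q solf]] := sol f tf D; have [Ltf0 [q0 solf0]] := sol f0 tf0 D0.
(* The parts of [f] and [f0] are real solutions in their own right. The given representatives are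
   first exchanged for [f], [tf], [f0] and [tf0]. *)
have half e e' : half_ip a b rho e e' u v0 = half_ip a b rho e e' v u0.
  have mf := primitive_oi _ _ (solf e).1; have mf0 := primitive_oi _ _ (solf0 e').1.
  have mt := L1_measurable tf e Ltf; have mt0 := L1_measurable tf0 e' Ltf0.
  have [i1 e1] : intg rho (oi a b) (fun t => part e (f t) * part e' (tf0 t)) /\
      half_ip a b rho e e' u v0 = \int[rho]_(t in oi a b) (part e (f t) * part e' (tf0 t)).
    apply: ae_intg => //; first exact: measurable_funM.
      apply: filterS2 uf vf0 => t h1 h2 abt; by rewrite h1 ?h2.
    exact: L2_product.
  have [i2 e2] : intg rho (oi a b) (fun t => part e (tf t) * part e' (f0 t)) /\
      half_ip a b rho e e' v u0 = \int[rho]_(t in oi a b) (part e (tf t) * part e' (f0 t)).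
    apply: ae_intg => //; first exact: measurable_funM.
      apply: filterS2 vf uf0 => t h1 h2 abt; by rewrite h1 ?h2.
    exact: L2_product.
  rewrite e1 e2 !(density_Rint mu rho r dr)//.
  apply: (compact_lagrange mu a b mufin ab s x r _ sx0 sr0 _ _ (q e) _ _ (q0 e') _ c d) => //.
  - exact: (signed_density_measurable mu sp sn s1 s2).
  - exact: (support_density mu a b sp sn s1 s2 ds1 ds2 lfs full).
  - exact: (L1locP_locint mu a b rho r dr).
  - exact: (L1locP_locint mu a b rho r dr).
  - by move=> t abt out; rewrite supp0// part0.
  - by apply/(density_intg mu rho r dr) => //; exact: (intg_meas _ _ _ i1).
have [re1 im1] := part_ip a b rho u v0 Lu Lv0; have [re2 im2] := part_ip a b rho v u0 Lv Lu0.
by apply: part_eq => -[]; rewrite ?re1 ?re2 ?im1 ?im2 !half.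
Qed.

Lemma adjoint_sub_Tmax u v : adjoint a b rho (T0 a b rho sp sn xp xn) u v ->
  Tmax a b rho sp sn xp xn u v.
Proof.
move=> [Lu [Lv adj]].
have Lu1 := L2_L1locP a b rho u lfr Lu; have Lv1 := L2_L1locP a b rho v lfr Lv.
have luv (h : R -> C) e : L1locP a b rho h -> locint mu a b (fun t => part e (h t) * r t).
  exact: (L1locP_locint mu a b rho r dr).
(* This supplies the imaginary part of the real test pairs below. *)
have zero : solution mu a b s x (fun=> 0) (fun=> 0) (fun=> 0).
  have z0 w : (forall t, w t = 0) -> primitive mu a b (fun=> 0) w.
    move=> w0; split; first by apply: (locint_ext mu a b (fun=> 0)) => // c d _ _; exact: intg0.
    move=> al be _ _ _; rewrite (eq_Rint _ _ _ (fun=> 0)) ?subrr//.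
    by rewrite /Rintegral integral0.
  by split; apply: z0 => t; rewrite ?mul0r ?subrr.
have key e : exists F q, solution mu a b s x F q (fun t => part e (v t) * r t) /\
    forall c d : R, (a < c%:E)%E -> (d%:E < b)%E ->
      ae_eq mu `[c, d]%classic (fun t => ((part e (u t) - F t) * r t)%:E) (cst 0%E).
  apply: (adjoint_solution mu a b mufin s x r ls lx lr sx0 sr0 ab) => //; try exact: luv.
  move=> y p w c d ac db tw sol spy spw.
  have cdo : `[c, d]%classic `<=` oi a b by move=> t; exact: oi_itv.
  have [mw [Cw hw] _] := tw.
  (* Against functions with imaginary part 0, the real and imaginary parts of the inner product
     isolate those of [u] and [v]. *)
  pose Y t := complex.Complex (y t) 0 : C; pose W t := complex.Complex (w t) 0 : C.
  have my : measurable_fun `[c, d]%classic y.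
    exact: (primitive_measurable mu a b mufin _ _ c d sol.1 ac db).
  have [Cy hy] := primitive_bounded mu a b _ _ c d sol.1 ac db.
  have L2_supp (z : R -> R) (B : R) : measurable_fun `[c, d]%classic z ->
      (forall t, `[c, d]%classic t -> `|z t| <= B) -> supported c d z ->
      L2 a b rho (fun t => complex.Complex (z t) 0).
    move=> mz zB sz; have mz' : measurable_fun (oi a b) z.
      rewrite (_ : z = z \_ `[c, d]%classic).
        apply: (measurable_restrict z (measurable_itv _) mo).1.
        by rewrite setIidr.
      by apply/funext => t; rewrite patchE; case: ifPn => // /negP nt;
        rewrite sz// => tcd; apply: nt; rewrite inE.
    split => //; split; first exact: measurable_cst.
    have i2 : intg rho (oi a b) (fun t => z t ^+ 2 + 0 ^+ 2).
      apply: (integrableS measurableT) => //.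
      apply: (intg_support rho `[c, d]%classic) => //.
        by move=> t nt; rewrite sz// expr0n/= addr0.
      apply: (intg_bounded _ _ (B ^+ 2)) => //; first exact: lfr.2.
        by apply: measurable_funD => //; exact: measurable_funX.
      move=> t tcd; rewrite expr0n/= addr0 normrX lerXn2r ?nnegrE//; last exact: zB.
      exact: le_trans (zB _ tcd).
    by move/integrableP: i2 => [_]; congr (_ < _)%E; apply: eq_integral => t _ /=;
      rewrite ger0_norm// addr_ge0 ?sqr_ge0.
  have LY : L2 a b rho Y by exact: L2_supp hy spy.
  have LW : L2 a b rho W.
    by apply: (L2_supp w Cw) => //; exact: measurable_funTS.
  have T0YW : T0 a b rho sp sn xp xn Y W.
    split => //; split => //; exists Y, W; split.
      apply: (solution_Dtau mu a b rho sp sn xp xn r s1 s2 x1 x2 mufin ab dr ds1 ds2 dx1 dx2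
        lfs.1 lfs.2.1 lfx.1 lfx.2.1 _ _ (fun e => if e then p else fun=> 0)).
        exact: L2_L1locP.
      case; first exact: sol.
      by apply: (solution_eq mu a b s x) zero => // t _ /=; rewrite mul0r.
    split; last by split; apply: aeW.
    exists c, d; split => //; split => // t abt out; congr complex.Complex.
    apply: spy; rewrite /= in_itv/= => /andP[ct td].
    by case: out => [/(le_lt_trans ct)|/lt_le_trans/(_ td)]; rewrite ltxx.
  have := adj Y W T0YW.
  have [re1 im1] := part_ip a b rho u W Lu LW; have [re2 im2] := part_ip a b rho v Y Lv LY.
  have h0 (h g : R -> C) e' : (forall t, part false (g t) = 0) ->
      half_ip a b rho e' false h g = 0.
    move=> g0; rewrite /half_ip (eq_Rint _ _ _ (fun=> 0)); last by move=> t _; rewrite g0 mulr0.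
    by rewrite /Rintegral integral0.
  have ht (h : R -> C) (z : R -> R) : L1locP a b rho h -> L2 a b rho h ->
      L2 a b rho (fun t => complex.Complex (z t) 0) -> supported c d z ->
      half_ip a b rho e true h (fun t => complex.Complex (z t) 0) =
      \int[mu]_(t in `[c, d]%classic) (part e (h t) * z t * r t).
    move=> L1h L2h Lz sz; have ip := L2_product a b rho h _ e true L2h Lz.
    rewrite /half_ip (Rint_support rho `[c, d]%classic)//; last first.
      by move=> t _ nt; rewrite /= sz// mulr0.
    rewrite (density_Rint mu rho r dr)//.
    by apply: integrableS ip.
  rewrite -(ht u w Lu1 Lu LW spw) -(ht v y Lv1 Lv LY spy) => eqip.
  move: (congr1 (part true) eqip) (congr1 (part false) eqip).
  rewrite re1 re2 im1 im2 !h0// !addr0 !subr0 => eqt eqf.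
  by clear ht; case: e.
have [Ft [qt [st at_]]] := key true; have [Ff [qf [sf af]]] := key false.
(* The representative of [u] in the domain; its image is [v] itself. *)
pose F t := complex.Complex (Ft t) (Ff t) : C.
split => //; split => //; exists F, v; split.
  apply: (solution_Dtau mu a b rho sp sn xp xn r s1 s2 x1 x2 mufin ab dr ds1 ds2 dx1 dx2
    lfs.1 lfs.2.1 lfx.1 lfx.2.1 _ _ (fun e => if e then qt else qf)) => //.
  by case.
split; last by apply: aeW.
have neg e (G q' : R -> R) : solution mu a b s x G q' (fun t => part e (v t) * r t) ->
    (forall c d : R, (a < c%:E)%E -> (d%:E < b)%E ->
      ae_eq mu `[c, d]%classic (fun t => ((part e (u t) - G t) * r t)%:E) (cst 0%E)) ->
    rho.-negligible (oi a b `&` [set t | part e (u t) <> G t]).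
  move=> sol ae; apply: negligible_oi => c d ac db.
  apply: (weight_ae mu rho r dr) => //.
  - exact: lfr.2.
  - apply: measurable_funS (L2_measurable a b rho u e Lu) => //.
    by move=> t; exact: oi_itv.
  - exact: (primitive_measurable mu a b mufin _ _ c d sol.1 ac db).
  - exact: ae.
have := negligibleU (neg _ _ _ st at_) (neg _ _ _ sf af).
apply: negligibleS => t /= /not_implyP[abt ne].
have [et|nt] := pselect (part true (u t) = Ft t); last by left.
right; split => // ef; apply: ne; apply: part_eq => -[]; [exact: et|exact: ef].
Qed.

End Main.

Lemma locfin_add {R : realType} (a b : \bar R) (m1 m2 : {measure set R -> \bar R}) :
  locfin a b m1 -> locfin a b m2 ->
  exists m : {measure set R -> \bar R},
    locfin a b m /\ forall A, (m A = m1 A + m2 A)%E.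
Proof.
move=> [z1 f1] [z2 f2].
have [m mE] : exists m : {measure set R -> \bar R}, forall A, (m A = m1 A + m2 A)%E.
  by exists (measure_add m1 m2) => A; exact: measure_addE.
exists m; split => //; split; first by rewrite mE z1 z2 adde0.
by move=> c d ac db; rewrite mE lte_add_pinfty ?f1 ?f2.
Qed.

Theorem theorem4p4 (R : realType) (a b : \bar R)
  (rho sp sn xp xn : {measure set R -> \bar R}) :
  (a < b)%E ->
  (* (H1) rho positive, locally finite on (a,b) *)
  locfin a b rho ->
  (* (H2) chi = xp - xn real-valued, locally finite *)
  locfin_signed a b xp xn ->
  (* (H3) sigma = sp - sn real-valued, locally finite, supp sigma = (a,b) *)
  locfin_signed a b sp sn ->
  (forall x, oi a b x -> supp a b (fun A => sp A + sn A)%E x) ->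
  (* (H4) *)
  (forall x, oi a b x ->
     smass sp sn x * smass xp xn x = 0 /\
     smass sp sn x * fine (rho [set x]) = 0) ->
  (* (H5) *)
  (forall al be, gap a b rho al be ->
     forall f, (exists tf, Dtau a b rho sp sn xp xn f tf) ->
       left_lim0 f al -> right_lim0 f be ->
       forall x, al < x < be -> f x = 0) ->
  (* (H6) *)
  (exists x y, x <> y /\ supp a b rho x /\ supp a b rho y) ->
  forall u v,
    adjoint a b rho (T0 a b rho sp sn xp xn) u v <->
    Tmax a b rho sp sn xp xn u v.
Proof.
move=> _ lfr lfx lfs full atoms _ [y [_ [_ [[aby _] _]]]] u v.
have ab : exists c, oi a b c by exists y.
have [m1 [l1 m1E]] := locfin_add a b _ _ lfx.1 lfx.2.1.
have [m2 [l2 m2E]] := locfin_add a b _ _ lfs.2.1 l1.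
have [m3 [l3 m3E]] := locfin_add a b _ _ lfs.1 l2.
have [m4 [l4 m4E]] := locfin_add a b _ _ lfr l3.
(* The sum of the five measures dominates each of them, and it is finite on compact subintervals,
   hence sigma-finite. *)
pose mu : {sigma_finite_measure set R -> \bar R} :=
  locfin_copy m4 (locfin_sigma_finite a b m4 ab l4).
have muE A : mu A = (rho A + (sp A + (sn A + (xp A + xn A))))%E.
  by rewrite -m1E -m2E -m3E -m4E.
have mufin c d : (a < c%:E)%E -> (d%:E < b)%E -> (mu `[c, d]%classic < +oo)%E := l4.2 c d.
have [r dr] : exists r, is_density mu rho r.
  by apply: (locfin_density a b) => // A mA; rewrite muE leeDl// !adde_ge0.
have [s1 ds1] : exists s1, is_density mu sp s1.
  apply: (locfin_density a b) => //; first exact: lfs.1.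
  by move=> A mA; rewrite muE addeCA leeDl// !adde_ge0.
have [s2 ds2] : exists s2, is_density mu sn s2.
  apply: (locfin_density a b) => //; first exact: lfs.2.1.
  by move=> A mA; rewrite muE addeA addeCA leeDl// !adde_ge0.
have [x1 dx1] : exists x1, is_density mu xp x1.
  apply: (locfin_density a b) => //; first exact: lfx.1.
  by move=> A mA; rewrite muE !addeA addeAC leeDr// !adde_ge0.
have [x2 dx2] : exists x2, is_density mu xn x2.
  apply: (locfin_density a b) => //; first exact: lfx.2.1.
  by move=> A mA; rewrite muE !addeA leeDr// !adde_ge0.
split.
  exact: (adjoint_sub_Tmax mu a b rho sp sn xp xn r s1 s2 x1 x2).
exact: (Tmax_sub_adjoint mu a b rho sp sn xp xn r s1 s2 x1 x2).
Qed.
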